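(* Fix a finite set $\Sigma$ with $|\Sigma|\geq 2$. Every hereditary ordered graph property over $\Sigma$ is strongly testable.
   Context: An (edge-colored, vertex-ordered) graph over $\Sigma$ is a function $G:\binom{V}{2}\to\Sigma$, where $V$ is a totally ordered finite vertex set (e.g. $V=[n]$ with its natural order). For $U\subseteq V$ with elements $u_1<\dots<u_k$, the ordered (induced) subgraph of $G$ on $U$ is $H:\binom{[k]}{2}\to\Sigma$ with $H(ij)=G(u_iu_j)$ for $i<j$. An ordered graph property is a collection of such graphs; it is hereditary if it is closed under taking ordered induced subgraphs. A graph $G:\binom{[n]}{2}\to\Sigma$ is $\epsilon$-far from a property $\mathcal{P}$ if one must change the value $G(ij)$ for at least $\epsilon\binom{n}{2}$ pairs $ij$ to obtain a graph in $\mathcal{P}$. A tester for $\mathcal{P}$ is a randomized algorithm that gets $\epsilon>0$ and query access to $G$ (a query reveals $G(ij)$ for a pair $ij$); it has one-sided error if it always accepts graphs in $\mathcal{P}$ and rejects graphs $\epsilon$-far from $\mathcal{P}$ with probability at least $2/3$. $\mathcal{P}$ is strongly testable if it has a one-sided error tester whose number of queries is bounded by a function $Q(\mathcal{P},\epsilon)$ independent of the input size $n$. *)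

(* Defs.v *)
From mathcomp Require Import all_boot all_order all_algebra.
From mathcomp Require Import reals.

Set Implicit Arguments.
Unset Strict Implicit.
Unset Printing Implicit Defensive.

Import Order.TTheory GRing.Theory Num.Theory.
Local Open Scope ring_scope.

(* A two-element subset of [n], written with its smaller element first. *)
Definition vpair (n : nat) : Type := {p : 'I_n * 'I_n | (p.1 < p.2)%N}.

Definition ograph (Sigma : finType) (n : nat) : Type := {ffun vpair n -> Sigma}.

Definition increasing (k n : nat) (u : 'I_k -> 'I_n) : Prop :=
  forall i j : 'I_k, (i < j)%N -> (u i < u j)%N.

Definition vpair_map (k n : nat) (u : 'I_k -> 'I_n) (hu : increasing u)
    (p : vpair k) : vpair n :=
  exist _ (u (sval p).1, u (sval p).2) (hu _ _ (svalP p)).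

(* A vertex subset u_1 < ... < u_k is given by its increasing enumeration. *)
Definition induced (Sigma : finType) (k n : nat) (G : ograph Sigma n)
    (u : 'I_k -> 'I_n) (hu : increasing u) : ograph Sigma k :=
  [ffun p => G (vpair_map hu p)].

Definition ograph_property (Sigma : finType) : Type :=
  forall n : nat, ograph Sigma n -> Prop.

Definition hereditary (Sigma : finType) (P : ograph_property Sigma) : Prop :=
  forall (n : nat) (G : ograph Sigma n), P n G ->
  forall (k : nat) (u : 'I_k -> 'I_n) (hu : increasing u),
    P k (induced G hu).

Definition edit_distance (Sigma : finType) (n : nat) (G H : ograph Sigma n) :
    nat :=
  #|[set p : vpair n | G p != H p]|.

(* When n >= 2 and eps > 0 the conjunct [~ P n G] follows from the second one.
   It only matters for n <= 1, where 'C(n, 2) = 0: without it a graph of P on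
   at most one vertex would be far from P. *)
Definition far (R : realType) (Sigma : finType) (P : ograph_property Sigma)
    (eps : R) (n : nat) (G : ograph Sigma n) : Prop :=
  ~ P n G /\
  forall H : ograph Sigma n, P n H ->
    eps * 'C(n, 2)%:R <= (edit_distance G H)%:R.

(* Randomized adaptive query algorithms on n-vertex inputs: halt with a verdict
   (true means accept), query a pair and continue according to its color, or
   draw a fresh uniform element of {0, ..., m} and continue according to it. *)
Inductive algorithm (Sigma : finType) (n : nat) : Type :=
| Halt of bool
| Query of vpair n & (Sigma -> algorithm Sigma n)
| Draw (m : nat) of ('I_m.+1 -> algorithm Sigma n).

Fixpoint pr_output (R : realType) (Sigma : finType) (n : nat)
    (G : ograph Sigma n) (b : bool) (A : algorithm Sigma n) : R :=
  match A with
  | Halt c => (c == b)%:R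
  | Query p k => pr_output R G b (k (G p))
  | Draw m k => (\sum_(i < m.+1) pr_output R G b (k i)) / m.+1%:R
  end.

(* The number of queries made on input G, maximized over the random draws. *)
Fixpoint num_queries (Sigma : finType) (n : nat) (G : ograph Sigma n)
    (A : algorithm Sigma n) : nat :=
  match A with
  | Halt _ => 0%N
  | Query p k => (num_queries G (k (G p))).+1
  | Draw m k => (\max_(i < m.+1) num_queries G (k i))%N
  end.

(* The algorithm is told eps and the number n of vertices; as only queries are
   counted, no computability is required of this dependence. *)
Definition query_algorithm (R : realType) (Sigma : finType) : Type :=
  R -> forall n : nat, algorithm Sigma n.

Definition one_sided_tester (R : realType) (Sigma : finType)
    (P : ograph_property Sigma) (T : query_algorithm R Sigma) : Prop :=
  forall eps : R, 0 < eps -> forall (n : nat) (G : ograph Sigma n),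
    (P n G -> pr_output R G true (T eps n) = 1) /\
    (far P eps G -> 2%:R / 3%:R <= pr_output R G false (T eps n)).

Definition strongly_testable (R : realType) (Sigma : finType)
    (P : ograph_property Sigma) : Prop :=
  exists (T : query_algorithm R Sigma) (Q : R -> nat),
    one_sided_tester P T /\
    forall eps : R, 0 < eps -> forall (n : nat) (G : ograph Sigma n),
      (num_queries G (T eps n) <= Q eps)%N.

(* Main.v *)
(* Suppose the property P is not testable at distance eps. Then there are graphs
   G_q, eps-far from P, of sizes tending to infinity, in which the proportion of
   q-tuples of vertices spanning a subgraph outside P tends to 0. Along a
   subsequence, choose vertex partitions into boundedly many classes whose energy
   cannot be increased any more by a refinement of bounded size, then a partition
   of the vertex order into K blocks in which the frequencies of the classes are
   stable in the same sense, and make all combinatorial data agree.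

   Fix a graph G of n vertices in the subsequence and take a much larger one G',
   with a regular partition W finer than all the others. Each vertex v of G is
   sent to a vertex y_v of G' of the same class, in a sub-block of the same block,
   in such a way that order is preserved: the vertices of a block go to the
   consecutive sub-blocks of a random window. Every color having positive density
   between the W-cells of y_v and y_w is allowed for the pair vw. By stability,
   the color G(vw) is already allowed for all but few pairs; changing the other
   pairs gives a graph H which, by regularity, has a positive proportion of
   copies in G', so H is in P. This contradicts that G is far from P.

   As the guide G' grows while n is fixed, there are n disjoint sub-blocks
   available inside every block, so pairs inside a block need no Ramsey argument. *)
Require Import Defs.
From mathcomp Require Import all_boot all_order all_algebra.
From mathcomp Require Import reals boolp.
From mathcomp Require Import ring lra zify.

Set Implicit Arguments.
Unset Strict Implicit.
Unset Printing Implicit Defensive.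

Import Order.TTheory GRing.Theory Num.Theory.
Local Open Scope ring_scope.

(** * Conditional expectations over finite partitions, and their energy *)

Section ConditionalExpectation.
Variables (R : realFieldType) (X : finType).

(** A partition is encoded by a labelling. Its classes are indexed by their points, so none is empty
    and the division in [cexp] is by a positive number. *)
Definition cell (L : eqType) (pi : X -> L) (x : X) : {set X} :=
  [set y | pi y == pi x].

Definition cexp (L : eqType) (pi : X -> L) (f : X -> R) (x : X) : R :=
  (\sum_(y in cell pi x) f y) / #|cell pi x|%:R.

Definition refines (L L' : eqType) (pi' : X -> L') (pi : X -> L) : Prop :=
  forall x y, pi' x = pi' y -> pi x = pi y.

Definition energy (L : eqType) (pi : X -> L) (f : X -> R) : R :=
  \sum_x cexp pi f x ^+ 2.

Lemma cell_id (L : eqType) (pi : X -> L) x : x \in cell pi x.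
Proof. by rewrite inE. Qed.

Lemma cell_eq (L : eqType) (pi : X -> L) x y : y \in cell pi x -> cell pi y = cell pi x.
Proof. by rewrite inE => /eqP e; apply/setP => z; rewrite !inE e. Qed.

Lemma cell_gt0 (L : eqType) (pi : X -> L) x : (0 < #|cell pi x|)%N.
Proof. by apply/card_gt0P; exists x; exact: cell_id. Qed.

Lemma cellR_gt0 (L : eqType) (pi : X -> L) x : 0 < #|cell pi x|%:R :> R.
Proof. by rewrite ltr0n cell_gt0. Qed.

Lemma cexp_eq (L : eqType) (pi : X -> L) f x y :
  y \in cell pi x -> cexp pi f y = cexp pi f x.
Proof. by move=> h; rewrite /cexp (cell_eq h). Qed.

Lemma cexp_ge0 (L : eqType) (pi : X -> L) f x :
  (forall y, 0 <= f y) -> 0 <= cexp pi f x.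
Proof. by move=> h; rewrite divr_ge0 // sumr_ge0. Qed.

Lemma cexp_le1 (L : eqType) (pi : X -> L) f x :
  (forall y, f y <= 1) -> cexp pi f x <= 1.
Proof.
move=> h; rewrite ler_pdivrMr ?cellR_gt0 // mul1r -sum1_card natr_sum.
exact: ler_sum.
Qed.

(** After expanding [cexp] and exchanging the sums, each [y] is met once for every [x] of its cell;
    as [h] is constant there, the cell size cancels. *)
Lemma sum_cexpM (L : eqType) (pi : X -> L) (f h : X -> R) :
  (forall x y, pi x = pi y -> h x = h y) ->
  \sum_x cexp pi f x * h x = \sum_x f x * h x.
Proof.
move=> hh.
transitivity (\sum_x \sum_(y in cell pi x) f y * (h y / #|cell pi y|%:R)).
  apply: eq_bigr => x _; rewrite /cexp -mulrA mulr_suml.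
  apply: eq_bigr => y yx; rewrite (cell_eq yx) [_^-1 * _]mulrC.
  by move: yx; rewrite inE => /eqP/hh ->.
rewrite (exchange_big_dep xpredT) //=; apply: eq_bigr => y _.
rewrite -mulr_sumr; congr (_ * _).
rewrite (eq_bigl (mem (cell pi y))) => [|x]; last by rewrite !inE eq_sym.
by rewrite sumr_const -[LHS]mulr_natr divfK // gt_eqF ?cellR_gt0.
Qed.

(** Pythagoras: [cexp] is an orthogonal projection, and the coarser expectation is constant on the
    finer cells, so the increment is orthogonal to it. *)
Lemma energy_gain (L L' : eqType) (pi' : X -> L') (pi : X -> L) f :
  refines pi' pi ->
  \sum_x (cexp pi' f x - cexp pi f x) ^+ 2 = energy pi' f - energy pi f.
Proof.
move=> ref.
have e1 : energy pi f = \sum_x f x * cexp pi f x.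
  rewrite -(sum_cexpM (pi := pi)); first by apply: eq_bigr => x _; rewrite expr2.
  by move=> x y e; apply: cexp_eq; rewrite inE e.
have e2 : \sum_x cexp pi' f x * cexp pi f x = energy pi f.
  rewrite e1; apply: sum_cexpM => x y /ref e.
  by apply: cexp_eq; rewrite inE e.
rewrite (eq_bigr (fun x => cexp pi' f x ^+ 2 - cexp pi' f x * cexp pi f x *+ 2
   + cexp pi f x ^+ 2)) => [|x _]; last by rewrite sqrrB.
rewrite big_split /= sumrB sumrMnl e2 -/(energy pi' f) -/(energy pi f); ring.
Qed.

Lemma energy_ge0 (L : eqType) (pi : X -> L) f : 0 <= energy pi f.
Proof. by apply: sumr_ge0 => x _; exact: sqr_ge0. Qed.

Lemma energy_le (L : eqType) (pi : X -> L) f :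
  (forall y, 0 <= f y <= 1) -> energy pi f <= #|X|%:R.
Proof.
move=> h; rewrite -sum1_card natr_sum; apply: ler_sum => x _.
rewrite expr_le1 ?cexp_ge0 ?cexp_le1 // => y; by case/andP: (h y).
Qed.

Lemma sum_cexp_sub (L : eqType) (pi : X -> L) f (A : {set X}) :
  (forall x y, pi x = pi y -> (x \in A) = (y \in A)) ->
  \sum_(y in A) cexp pi f y = \sum_(y in A) f y.
Proof.
move=> ref; have := @sum_cexpM _ pi f (fun y => (y \in A)%:R).
have H (h : X -> R) : \sum_x h x * (x \in A)%:R = \sum_(x in A) h x.
  rewrite [RHS]big_mkcond; apply: eq_bigr => y _.
  by case: ifP; rewrite ?mulr1 ?mulr0.
by rewrite !H; apply => x y /ref ->.
Qed.

End ConditionalExpectation.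

(** * Infinite index sets and stabilization by energy increments *)

Definition infinite_set (A : nat -> Prop) : Prop :=
  forall b, exists2 N, (b <= N)%N & A N.

Lemma pigeonhole_infinite (T : finType) (A : nat -> Prop) (phi : nat -> T) :
  infinite_set A -> exists t, infinite_set (fun N => A N /\ phi N = t).
Proof.
move=> infA; apply: contrapT => no.
have bnd t : exists b, forall N, (b <= N)%N -> A N -> phi N <> t.
  apply: contrapT => h; apply: no; exists t => b; apply: contrapT => h'.
  apply: h; exists b => N bN AN e; apply: h'; exists N => //; by split.
have [b hb] := choice bnd.
have [N bN AN] := infA (\max_t b t)%N.
by apply: (hb (phi N) N _ AN) => //; apply: leq_trans bN; exact: leq_bigmax.
Qed.

Section Stabilization.
Variables (R : realType) (X : nat -> Type).
Variables (ref : forall N, X N -> X N -> Prop).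
Variables (complexity : forall N, X N -> nat) (e : forall N, X N -> R).
Hypothesis ref_refl : forall N (x : X N), ref x x.
Hypothesis ref_trans : forall N (x y z : X N), ref x y -> ref y z -> ref x z.
Arguments complexity {N}.
Arguments e {N}.

(* Each failure of the conclusion provides, along a subsequence, a refinement
   of bounded complexity gaining [eps]; this happens at most [C / eps] times. *)
Lemma stabilize (C eps : R) (A0 : nat -> Prop) (x0 : forall N, X N) (M0 : nat) :
  0 < eps -> (forall N (x : X N), A0 N -> 0 <= e x <= C) ->
  infinite_set A0 -> (forall N, A0 N -> (complexity (x0 N) <= M0)%N) ->
  exists (A : nat -> Prop) (x : forall N, X N) (M : nat),
  [/\ infinite_set A, forall N, A N -> A0 N,
      forall N, A N -> ref (x0 N) (x N) /\ (complexity (x N) <= M)%N &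
      forall M', exists N0, forall N, (N0 <= N)%N -> A N ->
        forall y : X N, ref (x N) y -> (complexity y <= M')%N ->
          e y <= e (x N) + eps].
Proof.
move=> eps0 eC infA0 cx0; apply: contrapT => no.
have step j : exists (A : nat -> Prop) (x : forall N, X N) (M : nat),
  [/\ infinite_set A, forall N, A N -> A0 N,
      forall N, A N -> ref (x0 N) (x N) /\ (complexity (x N) <= M)%N &
      forall N, A N -> j%:R * eps <= e (x N)].
  elim: j => [|j [A [x [M [infA subA xM ej]]]]].
    exists A0, x0, M0; split => // N AN; first by split; [exact: ref_refl | exact: cx0].
    by rewrite mul0r; case/andP: (eC _ (x0 N) AN).
  (* The negated conclusion for the current data: one bound [M'] admits gaining refinements at
     arbitrarily large [N]. *)
  have [M' hM'] : exists M', forall N0, exists2 N, (N0 <= N)%N & A N /\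
      exists y : X N, [/\ ref (x N) y, (complexity y <= M')%N & e (x N) + eps < e y].
    apply: contrapT => h; apply: no; exists A, x, M; split => // M'.
    apply: contrapT => h'; apply: h; exists M' => N0; apply: contrapT => h2.
    apply: h'; exists N0 => N N0N AN y lxy cy; rewrite leNgt; apply/negP => ey.
    by apply: h2; exists N => //; split => //; exists y.
  pose A' N := A N /\ exists y : X N,
    [/\ ref (x N) y, (complexity y <= M')%N & e (x N) + eps < e y].
  have [x' hx'] : exists x' : forall N, X N, forall N, A' N ->
     [/\ ref (x N) (x' N), (complexity (x' N) <= M')%N & e (x N) + eps < e (x' N)].
    have ex N : exists y : X N, A' N ->
      [/\ ref (x N) y, (complexity y <= M')%N & e (x N) + eps < e y].
      (* Outside [A'] the sequence keeps [x N] as a default value. *)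
      by case: (EM (A' N)) => [[_ [y hy]]|h]; [exists y | exists (x N)].
    by exists (fun N => sval (cid (ex N))) => N A'N; case: (cid (ex N)) => /= y; exact.
  exists A', x', M'; split.
  - by move=> b; have [N bN h] := hM' b; exists N.
  - by move=> N [AN _]; exact: subA.
  - move=> N A'N; have [l c _] := hx' N A'N; split => //.
    by apply: ref_trans l; case: (xM N) => //; case: A'N.
  - move=> N A'N; have [_ _ /ltW h] := hx' N A'N; apply: (le_trans _ h).
    by rewrite -natr1 mulrDl mul1r lerD2r; apply: ej; case: A'N.
(* So many increments of [eps] push the energy above its bound [C]. *)
have [A [x [M [infA subA _ ej]]]] := step (Num.bound (C / eps)).
have [N _ AN] := infA 0%N.
have /andP[le0 le1] := eC _ (x N) (subA _ AN).
have := le_trans (ej _ AN) le1; rewrite -ler_pdivlMr // leNgt.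
by case/negP; apply/archi_boundP/divr_ge0; [exact: le_trans le1 | exact: ltW].
Qed.

End Stabilization.

(** * Counting lemma for lower regular pairs *)

Section Embedding.
Variables (R : realFieldType) (V I : finType) (E : I -> I -> rel V).
Variables (r : rel I) (kappa delta : R) (W : I -> {set V}).

Definition edge_sum (e : rel V) (A B : {set V}) : R :=
  \sum_(x in A) \sum_(y in B) (e x y)%:R.

(** Only the lower half of regularity, with an absolute threshold [delta]: a lower bound on the
    number of copies requires no more. *)
Definition lower_regular (e : rel V) (A B : {set V}) : Prop :=
  forall A' B' : {set V}, A' \subset A -> B' \subset B ->
  kappa * #|A|%:R <= #|A'|%:R -> kappa * #|B|%:R <= #|B'|%:R ->
  delta * (#|A'|%:R * #|B'|%:R) <= edge_sum e A' B'.

Definition nbhd (e : rel V) (x : V) : {set V} := [set y | e x y].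

Lemma edge_sum_nbhd e (A B : {set V}) :
  edge_sum e A B = \sum_(x in A) #|B :&: nbhd e x|%:R.
Proof.
apply: eq_bigr => x _; rewrite -sum1_card natr_sum big_mkcond [RHS]big_mkcond.
by apply: eq_bigr => y _; rewrite !inE; do 2 case: ifP => //=; move=> -> //; case: (e x y).
Qed.

(** The function [f0] freezes the values outside [s], so that partial maps are counted as total
    functions; in the induction it records the vertices already placed. *)
Definition embeddings (s : seq I) (A : I -> {set V}) (f0 : {ffun I -> V}) :
    {set {ffun I -> V}} :=
  [set f : {ffun I -> V} | [&& [forall i, (i \notin s) ==> (f i == f0 i)],
    all (fun i => f i \in A i) s & pairwise (fun i j => E i j (f i) (f j)) s]].

Hypotheses (kappa0 : 0 < kappa) (delta0 : 0 < delta) (delta1 : delta <= 1).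
Hypothesis Wreg : forall i j, r i j -> lower_regular (E i j) (W i) (W j).

(** Greedy embedding: placing [i] at a vertex that is bad for no later [j] keeps a fraction [delta]
    of each candidate set [A j], and regularity leaves at most [kappa * #|W i|] bad vertices per
    [j]. [lambda] is the guaranteed relative size of the candidate sets; the size condition ensures
    [kappa * #|W i|] good choices at each step. *)
Lemma card_embeddings (s : seq I) (lambda : R) (A : I -> {set V}) (f0 : {ffun I -> V}) :
  uniq s -> pairwise r s ->
  (forall i, i \in s -> A i \subset W i /\ lambda * #|W i|%:R <= #|A i|%:R) ->
  kappa * (size s)%:R <= lambda * delta ^+ size s -> 0 <= lambda ->
  kappa ^+ size s * \prod_(i <- s) #|W i|%:R <= #|embeddings s A f0|%:R.
Proof.
elim: s lambda A f0 => [|i s IH] lambda A f0.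
  move=> _ _ _ _ _; rewrite big_nil mulr1 expr0 ler1n; apply/card_gt0P; exists f0.
  by rewrite inE /= andbT; apply/forallP => i; rewrite eqxx.
move=> /= /andP[inots us] /andP[/allP ris rs] AW hk lam0.
have hk1 : kappa * (size s)%:R <= lambda * delta * delta ^+ size s.
  by rewrite -mulrA -exprS; apply: le_trans hk; rewrite ler_wpM2l ?ler_nat // ltW.
have hk2 : kappa * (size s).+1%:R <= lambda.
  by apply: (le_trans hk); rewrite ler_piMr // exprn_ile1 // ltW.
pose bad j := [set x in A i | #|A j :&: nbhd (E i j) x|%:R < delta * #|A j|%:R].
have [AiW Aibig] := AW i (mem_head _ _).
have badle j : j \in s -> #|bad j|%:R <= kappa * #|W i|%:R.
  (* Otherwise regularity applies to [bad j] against [A j], although every vertex of [bad j] has too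
     few neighbours there. *)
  move=> js; rewrite leNgt; apply/negP => h.
  have [AjW Ajbig] := AW j (mem_behead (s := i :: s) js).
  have bA : bad j \subset W i.
    by apply: subset_trans AiW; apply/subsetP => x; rewrite inE => /andP[].
  have kj : kappa * #|W j|%:R <= #|A j|%:R.
    apply: le_trans Ajbig; rewrite ler_wpM2r //; apply: le_trans hk2.
    by rewrite ler_peMr ?ler1n ?(ltW kappa0).
  have := Wreg (ris _ js) bA AjW (ltW h) kj; rewrite edge_sum_nbhd leNgt => /negP; apply.
  have bpos : (0 < #|bad j|)%N.
    by rewrite -(ltr0n R); apply: le_lt_trans h; rewrite mulr_ge0 // ltW.
  have -> : delta * (#|bad j|%:R * #|A j|%:R) = \sum_(x in bad j) delta * #|A j|%:R.
    by rewrite sumr_const -[RHS]mulr_natr; ring.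
  have /card_gt0P[x0 x0b] := bpos.
  rewrite (bigD1 x0) //= [ltRHS](bigD1 x0) //= ltr_leD //.
    by move: x0b; rewrite inE => /andP[].
  by apply: ler_sum => x /andP[]; rewrite inE => /andP[_ /ltW].
pose good := [set x in A i | all (fun j => delta * #|A j|%:R <= #|A j :&: nbhd (E i j) x|%:R) s].
have goodle : kappa * #|W i|%:R <= #|good|%:R.
  have cov : (#|A i| <= #|good| + \sum_(j <- s) #|bad j|)%N.
    rewrite -!sum1_card; under [X in (_ <= _ + X)%N]eq_bigr do rewrite -sum1_card big_mkcond.
    rewrite [X in (_ <= X + _)%N]big_mkcond exchange_big -big_split /= [leqLHS]big_mkcond.
    apply: leq_sum => x _; case: ifP => // xA; rewrite inE xA /=.
    case: (boolP (all _ s)) => // /allPn[j js]; rewrite -ltNge => hj.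
    by rewrite (big_rem j js) /= inE xA hj.
  have sumb : \sum_(j <- s) #|bad j|%:R <= (size s)%:R * (kappa * #|W i|%:R).
    rewrite big_seq; apply: (le_trans (ler_sum _ badle)).
    by rewrite -big_seq big_const_seq count_predT iter_addr_0 -[leLHS]mulr_natl.
  have := cov; rewrite -(ler_nat R) natrD natr_sum => cov'.
  have h3 : (kappa * (size s).+1%:R) * #|W i|%:R <= lambda * #|W i|%:R by rewrite ler_wpM2r.
  move: h3; rewrite -natr1 => h3; lra.
pose Ax x j := A j :&: nbhd (E i j) x.
pose fx x : {ffun I -> V} := [ffun j => if j == i then x else f0 j].
have sub x : x \in good -> embeddings s (Ax x) (fx x) \subset
    [set f in embeddings (i :: s) A f0 | f i == x].
  move=> xg; apply/subsetP => f; rewrite !inE => /and3P[/forallP h1 /allP h2 h3].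
  have fi : f i = x by apply/eqP; have := h1 i; rewrite inots /= ffunE eqxx.
  rewrite /= fi eqxx andbT h3 andbT; move: xg; rewrite inE => /andP[-> _] /=.
  apply/and3P; split.
  - apply/forallP => j; rewrite inE negb_or; apply/implyP => /andP[ji js].
    by have := h1 j; rewrite js /= ffunE (negPf ji).
  - by apply/allP => j /h2; rewrite inE => /andP[].
  - by apply/allP => j /h2; rewrite !inE => /andP[].
(* Embeddings are sorted by the image of [i]; each good image contributes the count for [s] with
   candidate sets [Ax x]. *)
have -> : #|embeddings (i :: s) A f0| =
    (\sum_x #|[set f in embeddings (i :: s) A f0 | f i == x]|)%N.
  rewrite -sum1_card (partition_big (fun f : {ffun I -> V} => f i) xpredT) //=.
  by apply: eq_bigr => x _; rewrite -sum1_card; apply: eq_bigl => f; rewrite !inE.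
rewrite natr_sum big_cons exprS.
apply: (@le_trans _ _ (\sum_(x in good) kappa ^+ size s * \prod_(j <- s) #|W j|%:R)).
  rewrite sumr_const -[leRHS]mulr_natr.
  have := ler_wpM2r _ goodle => /(_ (kappa ^+ size s * \prod_(j <- s) #|W j|%:R)) h.
  suff : 0 <= kappa ^+ size s * \prod_(j <- s) #|W j|%:R by move/h; lra.
  by rewrite mulr_ge0 ?exprn_ge0 ?prodr_ge0 // ltW.
rewrite [leRHS](bigID (mem good)) /= -[leLHS]addr0 lerD ?sumr_ge0 //.
apply: ler_sum => x xg; apply: le_trans (_ : #|embeddings s (Ax x) (fx x)|%:R <= _); last first.
  by rewrite ler_nat subset_leq_card // sub.
apply: (IH (lambda * delta)) => //; last by rewrite mulr_ge0 // ltW.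
move=> j js; have [AjW Ajbig] := AW j (mem_behead (s := i :: s) js); split.
  by apply: subset_trans AjW; exact: subsetIl.
move: xg; rewrite inE => /andP[_ /allP/(_ j js)]; apply: le_trans.
have := ler_wpM2l (ltW delta0) Ajbig; lra.
Qed.

End Embedding.

(** * Irregular pairs and the energy gained from them *)

Section Irregularity.
Variables (R : realFieldType) (V Sigma T : finType) (E : Sigma -> rel V).
Variables (pi : V -> T) (kappa theta : R).
Hypotheses (kappa0 : 0 <= kappa) (theta0 : 0 <= theta).

Definition pair_label (L : eqType) (l : V -> L) (p : V * V) : L * L := (l p.1, l p.2).
Definition edge_fun (c : Sigma) (p : V * V) : R := (E c p.1 p.2)%:R.
Definition dens (L : eqType) (l : V -> L) (c : Sigma) (x y : V) : R :=
  cexp (pair_label l) (edge_fun c) (x, y).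

Lemma cell_pair (L : eqType) (l : V -> L) x y :
  cell (pair_label l) (x, y) = setX (cell l x) (cell l y).
Proof. by apply/setP => -[a b]; rewrite !inE /= /pair_label /= xpair_eqE. Qed.

Lemma sum_setX (A B : {set V}) (f : V * V -> R) :
  \sum_(p in setX A B) f p = \sum_(x in A) \sum_(y in B) f (x, y).
Proof.
rewrite pair_big /=; apply: eq_big => [[x y]|[x y] _] //=; first by rewrite !inE.
Qed.

Lemma densE (L : eqType) (l : V -> L) c x y :
  dens l c x y = edge_sum R (E c) (cell l x) (cell l y) / (#|cell l x|%:R * #|cell l y|%:R).
Proof. by rewrite /dens /cexp cell_pair sum_setX cardsX natrM. Qed.

(** A failure of lower regularity, phrased with labels instead of vertices so that a single choice
    serves all pairs of vertices in the two classes. *)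
Definition witness (s t : T) (c : Sigma) (w : {set V} * {set V}) : bool :=
  let fib u := [set x | pi x == u] in
  [&& w.1 \subset fib s, w.2 \subset fib t,
      kappa * #|fib s|%:R <= #|w.1|%:R, kappa * #|fib t|%:R <= #|w.2|%:R &
      edge_sum R (E c) w.1 w.2 <
      (edge_sum R (E c) (fib s) (fib t) / (#|fib s|%:R * #|fib t|%:R) - theta)
        * (#|w.1|%:R * #|w.2|%:R)].

Definition irregular (x y : V) : bool :=
  [exists c, exists w, witness (pi x) (pi y) c w].

Lemma regularP x y c : ~~ irregular x y -> 
  @lower_regular R V kappa (dens pi c x y - theta) (E c) (cell pi x) (cell pi y).
Proof.
move=> /existsPn/(_ c)/existsPn h A B sA sB kA kB.
have := h (A, B); rewrite /witness /= sA sB kA kB /= -leNgt densE.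
exact.
Qed.

Definition pick_witness (s t : T) (c : Sigma) : {set V} * {set V} :=
  odflt (set0, set0) [pick w | witness s t c w].

(** The common refinement of [pi] with all chosen witnesses: a vertex records, for each label and
    color, its membership in the witness set, once as first and once as second end of a pair. *)
Definition witness_label (x : V) : T * {set T * Sigma} * {set T * Sigma} :=
  (pi x, [set tc | x \in (pick_witness (pi x) tc.1 tc.2).1],
         [set sc | x \in (pick_witness sc.1 (pi x) sc.2).2]).

Lemma witness_label_refines : refines witness_label pi.
Proof. by move=> x y []. Qed.

Lemma card_witness_label :
  #|{: T * {set T * Sigma} * {set T * Sigma}}| =
    (#|T| * 2 ^ (#|T| * #|Sigma|) * 2 ^ (#|T| * #|Sigma|))%N.
Proof.
have card_setT (U : finType) : #|{set U}| = (2 ^ #|U|)%N.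
  by rewrite -(cardsT U) -card_powerset powersetT cardsT.
by rewrite !card_prod !card_setT card_prod.
Qed.

(** On a witness [A], [B] the refined expectation has mean below [d - theta], whereas the coarse one
    is constantly [d]. The squared difference therefore sums to at least
    [theta ^+ 2 * (#|A| * #|B|)], and the witness fills at least a [kappa ^+ 2] fraction of the
    rectangle of its two classes. *)
Lemma irregular_gain :
  theta ^+ 2 * kappa ^+ 2 * #|[set p : V * V | irregular p.1 p.2]|%:R <=
  \sum_c \sum_p (cexp (pair_label witness_label) (edge_fun c) p -
                 cexp (pair_label pi) (edge_fun c) p) ^+ 2.
Proof.
rewrite exchange_big /= -sum1_card natr_sum mulr_sumr big_mkcond /=.
rewrite (partition_big (pair_label pi) xpredT) //=.
rewrite [leRHS](partition_big (pair_label pi) xpredT) //=.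
apply: ler_sum => -[s t] _.
have ge0 (Q : pred (V * V)) : 0 <= \sum_(p | Q p) \sum_c (cexp (pair_label witness_label) (edge_fun c) p -
                 cexp (pair_label pi) (edge_fun c) p) ^+ 2.
  by apply: sumr_ge0 => p _; apply: sumr_ge0 => c _; exact: sqr_ge0.
case: (boolP [exists c, exists w, witness s t c w]) => [|irr]; last first.
  rewrite big1 // => -[x y] /eqP[e1 e2]; rewrite inE /irregular /= -/(pi x) e1 e2.
  by rewrite (negPf irr).
case/existsP => c /existsP[w0 w0P].
have : witness s t c (pick_witness s t c).
  by rewrite /pick_witness; case: pickP => //= /(_ w0); rewrite w0P.
case ew : (pick_witness s t c) => [A B] /and5P[/= sA sB kA kB lt].
pose fib u := [set x | pi x == u].
(* [setX A B] is a union of cells of the refined pair partition, so the refined expectation and the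
   edge function have equal sums over it. *)
have inv p q : pair_label witness_label p = pair_label witness_label q ->
    (p \in setX A B) = (q \in setX A B).
  case: p q => [x y] [x' y'] []; rewrite !inE /= => e1 e2 _ f1 _ f2.
  have mem1 : (x \in A) = (x' \in A).
    case: (eqVneq (pi x) s) => [es|ns].
      move/setP/(_ (t, c)): e2; rewrite !inE /= -e1 es ew /=; exact.
    have : x \notin A by apply: contra ns => /(subsetP sA); rewrite inE.
    have : x' \notin A by apply: contra ns => /(subsetP sA); rewrite inE e1.
    by move=> /negPf -> /negPf ->.
  have mem2 : (y \in B) = (y' \in B).
    case: (eqVneq (pi y) t) => [es|ns].
      move/setP/(_ (s, c)): f2; rewrite !inE /= -f1 es ew /=; exact.
    have : y \notin B by apply: contra ns => /(subsetP sB); rewrite inE.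
    have : y' \notin B by apply: contra ns => /(subsetP sB); rewrite inE f1.
    by move=> /negPf -> /negPf ->.
  by rewrite mem1 mem2.
set d := edge_sum R (E c) (fib s) (fib t) / (#|fib s|%:R * #|fib t|%:R).
have cst p : p \in setX A B -> cexp (pair_label pi) (edge_fun c) p = d.
  case: p => x y; rewrite inE /= => /andP[/(subsetP sA)] + /(subsetP sB).
  rewrite !inE => /eqP ex /eqP ey; rewrite -/(dens pi c x y) densE.
  by rewrite /d /fib /cell ex ey.
have tot := sum_cexp_sub (edge_fun c) inv.
rewrite [X in _ = X]sum_setX -/(edge_sum R (E c) A B) in tot.
apply: (@le_trans _ _ (\sum_(p in setX A B) (cexp (pair_label witness_label) (edge_fun c) p -
                 cexp (pair_label pi) (edge_fun c) p) ^+ 2)); last first.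
  rewrite [leRHS](bigID (mem (setX A B))) /= -[leLHS]addr0 lerD //.
  rewrite [leRHS](eq_bigl (mem (setX A B))); last first.
    case=> x y; rewrite !inE /=; apply: andb_idl => /andP[/(subsetP sA)] + /(subsetP sB).
    by rewrite !inE /pair_label /= => /eqP -> /eqP ->.
  apply: ler_sum => p _; rewrite (bigD1 c) //= lerDl sumr_ge0 // => *; exact: sqr_ge0.
(* A linear lower bound for the square, from [(u - d + theta) ^+ 2 >= 0], replaces
   Cauchy-Schwarz. *)
apply: (@le_trans _ _ (\sum_(p in setX A B) (2 * theta * (d - cexp (pair_label witness_label) (edge_fun c) p) - theta ^+ 2))); last first.
  apply: ler_sum => p /cst ->.
  by set u := cexp _ _ _; have := sqr_ge0 (u - d + theta); nra.
rewrite sumrB -mulr_sumr sumrB tot !sumr_const cardsX -[d *+ _]mulr_natr.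
rewrite -[theta ^+ 2 *+ _]mulr_natr natrM.
apply: (@le_trans _ _ (theta ^+ 2 * (#|A|%:R * #|B|%:R))); last first.
  have : theta * (theta * (#|A|%:R * #|B|%:R)) <= theta * (d * (#|A|%:R * #|B|%:R) - edge_sum R (E c) A B).
    by rewrite ler_wpM2l //; move: lt; rewrite -/fib -/d; lra.
  lra.
apply: (@le_trans _ _ (theta ^+ 2 * ((kappa * #|fib s|%:R) * (kappa * #|fib t|%:R)))); last first.
  by rewrite ler_wpM2l ?sqr_ge0 // ler_pM // mulr_ge0.
rewrite -big_mkcondr /= sumr_const -[leLHS]mulr_natr.
have : (#|[pred p | (pair_label pi p == (s, t)) && (p \in [set p | irregular p.1 p.2])]| <= #|fib s| * #|fib t|)%N.
  rewrite -cardsX; apply: subset_leq_card; apply/subsetP => -[x y].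
  by rewrite !inE /= => /andP[/eqP[-> ->] _]; rewrite !eqxx.
rewrite -(ler_nat R) natrM => h.
have := ler_wpM2l (mulr_ge0 (sqr_ge0 theta) (sqr_ge0 kappa)) h.
move=> h2; apply: le_trans (le_trans h2 _); last by lra.
by rewrite mulr1.
Qed.

End Irregularity.

(** * First moment method for independent choices *)

Section IndependentChoice.
Variables (R : realFieldType) (I Y : finType) (p : I -> Y -> R).
Hypothesis p_ge0 : forall i a, 0 <= p i a.
Hypothesis p_sum1 : forall i, \sum_a p i a = 1.

Let weight (f : {ffun I -> Y}) : R := \prod_i p i (f i).

Lemma sum_weightM (q : I -> Y -> R) :
  \sum_f weight f * \prod_i q i (f i) = \prod_i \sum_a p i a * q i a.
Proof.
by rewrite bigA_distr_bigA /=; apply: eq_bigr => f _; rewrite -big_split.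
Qed.

Lemma sum_weight : \sum_f weight f = 1.
Proof.
transitivity (\sum_f weight f * \prod_(i : I) 1).
  by apply: eq_bigr => f _; rewrite big1 // mulr1.
rewrite (sum_weightM (fun _ _ => 1)) big1 // => i _.
by under eq_bigr do rewrite mulr1; exact: p_sum1.
Qed.

Lemma sum_weight1 i (u : Y -> R) :
  \sum_f weight f * u (f i) = \sum_a p i a * u a.
Proof.
transitivity (\sum_f weight f * \prod_k (if k == i then u (f k) else 1)).
  by apply: eq_bigr => f _; rewrite -big_mkcond /= big_pred1_eq.
rewrite (sum_weightM (fun k y => if k == i then u y else 1)) (bigD1 i) //= eqxx.
rewrite [X in _ * X]big1 ?mulr1 // => k /negPf ->.
by under eq_bigr do rewrite mulr1; exact: p_sum1.
Qed.

Lemma sum_weight2 i j (u : Y -> Y -> R) : i != j ->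
  \sum_f weight f * u (f i) (f j) = \sum_a \sum_b p i a * p j b * u a b.
Proof.
move=> ij.
(* Splitting according to the value [a] of [f i] turns [u (f i) (f j)] into a product of
   one-variable factors. *)
transitivity (\sum_f \sum_a weight f *
    \prod_k (if k == i then (f k == a)%:R else if k == j then u a (f k) else 1)).
  apply: eq_bigr => f _; rewrite (bigD1 (f i)) //= [X in _ + X]big1 ?addr0.
    rewrite (bigD1 i) //= !eqxx mul1r (bigD1 j) 1?eq_sym //= (negPf ij) eqxx.
    rewrite big1 ?mulr1 // => k /andP[/negPf -> /negPf ->] //.
  move=> a ai; rewrite (bigD1 i) //= eqxx [f i == a]eq_sym (negPf ai) mul0r mulr0 //.
rewrite exchange_big /=; apply: eq_bigr => a _.
rewrite (sum_weightM (fun k y => if k == i then (y == a)%:R else if k == j then u a y else 1)).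
rewrite (bigD1 i) //= eqxx (bigD1 j) 1?eq_sym //= (negPf ij) eqxx.
rewrite [X in _ * (_ * X)]big1 ?mulr1 => [|k /andP[/negPf -> /negPf ->]]; last first.
  by under eq_bigr do rewrite mulr1; exact: p_sum1.
rewrite (bigD1 a) //= eqxx mulr1 [X in _ + X]big1 ?addr0 => [|b /negPf ->]; last first.
  by rewrite mulr0.
by rewrite mulr_sumr; apply: eq_bigr => b _; rewrite mulrA.
Qed.

(** The mean of [cost f - avg] is zero; were it positive at every outcome of positive weight, all
    weights would vanish. The positivity in the conclusion keeps each choice inside the support of
    its distribution, where the constraints on chosen points are encoded. *)
Lemma exists_le_average (u : I -> Y -> R) (F : I -> I -> Y -> Y -> R) :
  exists f : {ffun I -> Y}, (forall i, 0 < p i (f i)) /\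
    \sum_i u i (f i) + \sum_i \sum_(j | i != j) F i j (f i) (f j) <=
    \sum_i \sum_a p i a * u i a +
    \sum_i \sum_(j | i != j) \sum_a \sum_b p i a * p j b * F i j a b.
Proof.
pose avg := \sum_i \sum_a p i a * u i a +
    \sum_i \sum_(j | i != j) \sum_a \sum_b p i a * p j b * F i j a b.
rewrite -/avg; apply: contrapT => no.
pose cost (f : {ffun I -> Y}) := \sum_i u i (f i) + \sum_i \sum_(j | i != j) F i j (f i) (f j).
have w0 f : 0 <= weight f by apply: prodr_ge0 => i _.
have big (f : {ffun I -> Y}) : (forall i, 0 < p i (f i)) -> avg < cost f.
  by move=> pf; rewrite ltNge; apply/negP => le; apply: no; exists f.
have tot : \sum_f weight f * (cost f - avg) = 0.
  transitivity (\sum_f weight f * cost f - \sum_f weight f * avg).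
    by rewrite -sumrB; apply: eq_bigr => f _; rewrite mulrBr.
  rewrite -mulr_suml sum_weight mul1r.
  suff -> : \sum_f weight f * cost f = avg by rewrite subrr.
  transitivity (\sum_f (\sum_i weight f * u i (f i) +
      \sum_i \sum_(j | i != j) weight f * F i j (f i) (f j))).
    apply: eq_bigr => f _; rewrite /cost mulrDr !mulr_sumr; congr (_ + _).
    by apply: eq_bigr => i _; rewrite mulr_sumr.
  rewrite big_split /= exchange_big /=; congr (_ + _).
    by apply: eq_bigr => i _; exact: sum_weight1.
  rewrite exchange_big /=; apply: eq_bigr => i _; rewrite exchange_big /=.
  by apply: eq_bigr => j ij; exact: sum_weight2.
have w_eq0 (f : {ffun I -> Y}) : ~ (forall i, 0 < p i (f i)) -> weight f = 0.
  move=> /existsNP[i /negP]; rewrite -leNgt => pi0.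
  have pi_eq0 : p i (f i) = 0 by apply: le_anti; rewrite pi0 p_ge0.
  by rewrite /weight (bigD1 i) //= pi_eq0 mul0r.
have term_ge0 (f : {ffun I -> Y}) : 0 <= weight f * (cost f - avg).
  case: (EM (forall i, 0 < p i (f i))) => [/big/ltW h|/w_eq0 ->].
    by rewrite mulr_ge0 // subr_ge0.
  by rewrite mul0r.
have z (f : {ffun I -> Y}) : weight f = 0.
  case: (EM (forall i, 0 < p i (f i))) => [/big h|/w_eq0 //].
  have /eqP : weight f * (cost f - avg) = 0 by apply: (psumr_eq0P _ tot).
  by rewrite mulf_eq0 [cost f - avg == 0]gt_eqF ?subr_gt0 // orbF => /eqP.
by have := sum_weight; rewrite big1 // => /eqP; rewrite eq_sym oner_eq0.
Qed.

End IndependentChoice.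

(** * Division of the vertex order into intervals *)

Section Buckets.
Variable N : nat.

(** Rounding down makes the buckets for [K * d] exactly nested in those for [K], whatever the
    divisibility of [N]. *)
Definition bucket (M : nat) (x : 'I_N) : nat := (x * M %/ N)%N.

Lemma bucket_lt M x : (0 < M)%N -> (bucket M x < M)%N.
Proof. by move=> M0; rewrite ltn_divLR ?(leq_ltn_trans _ (ltn_ord x)) // mulnC ltn_mul2l M0 ltn_ord. Qed.

Lemma bucket_div K d x : (0 < d)%N -> (bucket (K * d) x %/ d = bucket K x)%N.
Proof. by move=> d0; rewrite /bucket -divnMA mulnA divnMr. Qed.

Lemma bucket_mono M (x y : 'I_N) : (x <= y)%N -> (bucket M x <= bucket M y)%N.
Proof. by move=> xy; rewrite leq_div2r // leq_mul2r xy orbT. Qed.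

Lemma card_ord_interval a b : (b <= N)%N -> #|[set x : 'I_N | (a <= x < b)%N]| = (b - a)%N.
Proof.
move=> bN; have lt (i : 'I_(b - a)) : (a + i < N)%N by have := ltn_ord i; lia.
have -> : [set x : 'I_N | (a <= x < b)%N] = [set Ordinal (lt i) | i in [set: 'I_(b - a)]].
  apply/setP => x; rewrite inE; apply/idP/imsetP => [/andP[ax xb]|[i _ ->] /=].
    have xlt : (x - a < b - a)%N by lia.
    by exists (Ordinal xlt) => //; apply: val_inj => /=; lia.
  by have := ltn_ord i; lia.
rewrite card_imset ?cardsT ?card_ord // => i j /(congr1 val) /= /addnI; exact: val_inj.
Qed.

Lemma card_bucket M t : (t < M)%N -> (2 * M <= N)%N ->
  (N <= 2 * M * #|[set x | bucket M x == t]|)%N /\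
  (M * #|[set x | bucket M x == t]| <= 2 * N)%N.
Proof.
move=> tM MN; have M0 : (0 < M)%N by exact: leq_ltn_trans tM.
have N0 : (0 < N)%N by lia.
(* The quotient [s * N / M] rounded up: the first vertex of bucket [s]. *)
pose a s := ((s * N + M.-1) %/ M)%N.
have aP s : (s * N <= a s * M < s * N + M)%N.
  have := divn_eq (s * N + M.-1) M; have := ltn_pmod (s * N + M.-1) M0.
  rewrite -/(a s); lia.
have aN s : (s <= M)%N -> (a s <= N)%N.
  move=> sM; have /andP[_ h] := aP s.
  have : (s * N <= M * N)%N by rewrite leq_mul2r sM orbT.
  move=> h2; have : (a s * M < (N + 1) * M)%N by lia.
  by rewrite ltn_mul2r => /andP[_]; lia.
have -> : [set x | bucket M x == t] = [set x : 'I_N | (a t <= x < a t.+1)%N].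
  apply/setP => x; rewrite !inE /bucket.
  have ax s : (a s <= x)%N = (s * N <= x * M)%N.
    have /andP[h1 h2] := aP s; apply/idP/idP => h.
      by apply: leq_trans h1 _; rewrite leq_mul2r h orbT.
    have : (a s * M < x.+1 * M)%N by rewrite mulSn; lia.
    by rewrite ltn_mul2r => /andP[_].
  rewrite [(x < _)%N]ltnNge !ax -ltnNge -leq_divRL // -ltn_divLR // ltnS eqn_leq andbC //.
rewrite card_ord_interval ?aN //.
have := aP t; have := aP t.+1; rewrite mulSn => /andP[h1 h2] /andP[h3 h4].
have : ((a t.+1 - a t) * M = a t.+1 * M - a t * M)%N by rewrite mulnBl.
move: (a t.+1 - a t)%N (a t.+1 * M)%N (a t * M)%N h1 h2 h3 h4 => d u v; nia.
Qed.

End Buckets.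

(** * The tester and its amplification *)

Section Tester.
Variables (R : realType) (Sigma : finType).
Implicit Type n : nat.

(** Nonadaptive queries: [acc] is a total graph overwritten by the answers, so that the decision can
    take a graph as argument. *)
Fixpoint query_all n (s : seq (vpair n)) (dec : ograph Sigma n -> bool)
    (acc : ograph Sigma n) : algorithm Sigma n :=
  if s is p :: s' then
    Query p (fun c => query_all s' dec [ffun x => if x == p then c else acc x])
  else @Halt Sigma n (dec acc).

Lemma pr_output_query_all n (G : ograph Sigma n) b s dec acc :
  pr_output R G b (query_all s dec acc) =
    (dec [ffun p => if p \in s then G p else acc p] == b)%:R.
Proof.
elim: s acc => [|p s IH] acc /=.
  by congr (nat_of_bool (dec _ == b))%:R; apply/ffunP => x; rewrite ffunE.
rewrite IH; congr (nat_of_bool (dec _ == b))%:R; apply/ffunP => x.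
rewrite !ffunE inE; case: (x \in s); first by rewrite orbT.
by rewrite orbF; case: eqP => [->|].
Qed.

Lemma num_queries_query_all n (G : ograph Sigma n) s dec acc :
  num_queries G (query_all s dec acc) = size s.
Proof. by elim: s acc => //= p s IH acc; rewrite IH. Qed.

(** [Draw m] has [m + 1] outcomes, hence the predecessor; the fallback [Halt] is reached only for
    empty [D]. *)
Definition draw_from n (D : finType) (alg : D -> algorithm Sigma n) :
    algorithm Sigma n :=
  @Draw Sigma n #|D|.-1 (fun i =>
    if (insub (val i) : option 'I_#|D|) is Some j then alg (enum_val j)
    else @Halt Sigma n true).

Lemma pr_output_draw_from n (G : ograph Sigma n) b (D : finType) (alg : D -> algorithm Sigma n) :
  (0 < #|D|)%N ->
  pr_output R G b (draw_from alg) = (\sum_d pr_output R G b (alg d)) / #|D|%:R.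
Proof.
move=> D0; rewrite /= prednK //; congr (_ / _).
pose g (i : nat) := pr_output R G b (if (insub i : option 'I_#|D|) is Some j
   then alg (enum_val j) else @Halt Sigma n true).
rewrite -(big_mkord xpredT g). rewrite big_mkord.
rewrite [RHS](reindex (@enum_val D predT)); last exact: onW_bij (enum_val_bij D).
by apply: eq_bigr => i _; rewrite /g valK.
Qed.

Lemma num_queries_draw_from n (G : ograph Sigma n) (D : finType)
    (alg : D -> algorithm Sigma n) q :
  (forall d, num_queries G (alg d) <= q)%N -> (num_queries G (draw_from alg) <= q)%N.
Proof. by move=> h; apply/bigmax_leqP => i _; case: insub. Qed.

Variable P : ograph_property Sigma.

(** Tuples may repeat vertices and come in any order, so they can be drawn uniformly among all
    functions; the increasing [u] runs through some of the values. *)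
Definition bad_tuple n (G : ograph Sigma n) q (f : 'I_q -> 'I_n) : Prop :=
  exists (k : nat) (u : 'I_k -> 'I_n) (hu : increasing u),
    (forall i, exists j, u i = f j) /\ ~ P (induced G hu).

Definition bad_tuples n (G : ograph Sigma n) q : {set {ffun 'I_q -> 'I_n}} :=
  [set f : {ffun 'I_q -> 'I_n} | `[< bad_tuple G f >]].

Lemma bad_tuple_eq n (G H : ograph Sigma n) q (f : 'I_q -> 'I_n) :
  (forall p : vpair n, (exists i, (sval p).1 = f i) -> (exists i, (sval p).2 = f i) -> G p = H p) ->
  bad_tuple G f -> bad_tuple H f.
Proof.
move=> GH [k [u [hu [uf nP]]]]; exists k, u, hu; split => //.
suff <- : induced G hu = induced H hu by [].
by apply/ffunP => p; rewrite !ffunE; apply: GH => /=; apply: uf.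
Qed.

(** A tuple with a bad prefix of length [r] is bad, so the proportion of bad tuples is nondecreasing
    in the length. The map [glue] exchanges the prefix with a given [r]-tuple, hence is
    injective. *)
Lemma bad_tuplesS n (G : ograph Sigma n) r q : (r <= q)%N ->
  (#|bad_tuples G r| * n ^ q <= #|bad_tuples G q| * n ^ r)%N.
Proof.
move=> rq.
pose glue (fg : {ffun 'I_r -> 'I_n} * {ffun 'I_q -> 'I_n}) :
    {ffun 'I_q -> 'I_n} * {ffun 'I_r -> 'I_n} :=
  ([ffun i : 'I_q => if insub (val i) is Some j then fg.1 j else fg.2 i],
   [ffun j : 'I_r => fg.2 (widen_ord rq j)]).
have glue_inj : injective glue.
  move=> [f g] [f' g'] [/ffunP e1 /ffunP e2]; congr pair; apply/ffunP => i.
    by have := e1 (widen_ord rq i); rewrite !ffunE /= valK.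
  case: (ltnP i r) => ir.
    have := e2 (Ordinal ir); rewrite !ffunE /=.
    by have -> : widen_ord rq (Ordinal ir) = i by exact: val_inj.
  by have := e1 i; rewrite !ffunE /= insubN // -leqNgt.
have -> : (n ^ q = #|[set: {ffun 'I_q -> 'I_n}]|)%N by rewrite cardsT card_ffun !card_ord.
have -> : (n ^ r = #|[set: {ffun 'I_r -> 'I_n}]|)%N by rewrite cardsT card_ffun !card_ord.
rewrite -!cardsX -(card_imset _ glue_inj); apply: subset_leq_card.
apply/subsetP => _ /imsetP[[f g] + ->]; rewrite !inE /= !andbT => /asboolP fbad.
apply/asboolP; case: fbad => k [u [hu [uf nP]]]; exists k, u, hu; split => // i.
by have [j ->] := uf i; exists (widen_ord rq j); rewrite ffunE /= valK.
Qed.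

(** All ordered pairs inside each block are listed; [insub] retains the increasing ones. *)
Definition block_pairs n q (F : {ffun 'I_q -> {ffun 'I_q -> 'I_n}}) : seq (vpair n) :=
  pmap insub [seq (F t.1.1 t.1.2, F t.1.1 t.2) | t <- enum {: 'I_q * 'I_q * 'I_q}].

Lemma size_block_pairs n q (F : {ffun 'I_q -> {ffun 'I_q -> 'I_n}}) :
  (size (block_pairs F) <= q ^ 3)%N.
Proof.
rewrite size_pmap; apply: leq_trans (count_size _ _) _.
by rewrite size_map -cardT !card_prod !card_ord !expnS expn0 muln1 mulnA.
Qed.

Lemma mem_block_pairs n q (F : {ffun 'I_q -> {ffun 'I_q -> 'I_n}}) (p : vpair n) i j j' :
  (sval p).1 = F i j -> (sval p).2 = F i j' -> p \in block_pairs F.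
Proof.
move=> e1 e2; rewrite mem_pmap_sub; apply/mapP; exists (i, j, j'); rewrite ?mem_enum //=.
by rewrite -e1 -e2; case: (sval p).
Qed.

(* The independent blocks amplify the probability [beta] of meeting a bad
   [q]-tuple: no block is bad with probability [(1 - beta) ^ q]. *)
Lemma testable_of_bad_tuples (c0 : Sigma) : hereditary P ->
  (forall eps : R, 0 < eps -> exists q, forall n (G : ograph Sigma n),
    (q < n)%N -> far P eps G -> (2 * n ^ q <= q * #|bad_tuples G q|)%N) ->
  strongly_testable R P.
Proof.
move=> hP tup.
have [Q hQ] : exists Q : R -> nat, forall eps, 0 < eps -> forall n (G : ograph Sigma n),
    (Q eps < n)%N -> far P eps G -> (2 * n ^ Q eps <= Q eps * #|bad_tuples G (Q eps)|)%N.
  have ex (eps : R) : exists q, 0 < eps -> forall n (G : ograph Sigma n),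
    (q < n)%N -> far P eps G -> (2 * n ^ q <= q * #|bad_tuples G q|)%N.
    case: (EM (0 < eps)) => [eps0|neps]; last by exists 0%N.
    by have [q hq] := tup eps eps0; exists q.
  by have [Q hQ] := choice ex; exists Q.
pose acc0 n : ograph Sigma n := [ffun=> c0].
pose nobad n q (F : {ffun 'I_q -> {ffun 'I_q -> 'I_n}}) (G : ograph Sigma n) :=
  F \in ffun_on (mem (~: bad_tuples G q)).
pose block n q F := @query_all n (block_pairs F) (@nobad n q F) (acc0 n).
(* Up to [Q eps] vertices the whole graph is read and decided exactly; beyond that, [Q eps] random
   blocks of [Q eps] vertices are inspected. *)
pose T (eps : R) n : algorithm Sigma n :=
  if (n <= Q eps)%N then query_all (enum {: vpair n}) (fun G => `[< P G >]) (acc0 n)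
  else draw_from (@block n (Q eps)).
(* Badness of a tuple depends only on the pairs inside its block, all of which are queried. *)
have pr_block n q (G : ograph Sigma n) F b :
    pr_output R G b (@block n q F) = (nobad n q F G == b)%:R.
  rewrite pr_output_query_all; congr (nat_of_bool (_ == b))%:R.
  rewrite /nobad; apply: eq_forallb => i; rewrite !inE; congr (~~ _).
  apply: asbool_equiv_eq; split; apply: bad_tuple_eq => p [j e1] [j' e2];
    by rewrite ffunE (mem_block_pairs e1 e2).
exists T, (fun eps => Q eps ^ 2 + Q eps ^ 3)%N; split => [eps eps0 n G|eps eps0 n G]; last first.
  rewrite /T; case: (leqP n (Q eps)) => nQ.
    rewrite num_queries_query_all -cardE; apply: leq_trans (leq_addr _ _).
    apply: leq_trans (_ : #|{: 'I_n * 'I_n}| <= _)%N; first exact: leq_card val_inj.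
    by rewrite card_prod card_ord -mulnn leq_mul.
  apply: num_queries_draw_from => F; rewrite num_queries_query_all.
  exact: leq_trans (size_block_pairs F) (leq_addl _ _).
rewrite /T; case: (leqP n (Q eps)) => nQ.
  have pr_all b : pr_output R G b (query_all (enum {: vpair n}) (fun G => `[< P G >]) (acc0 n)) =
      (`[< P G >] == b)%:R.
    rewrite pr_output_query_all; congr (nat_of_bool (`[< P _ >] == b))%:R.
    by apply/ffunP => p; rewrite ffunE mem_enum.
  rewrite !pr_all; split => [PG|[nPG _]]; first by rewrite asboolT.
  by rewrite asboolF //= ler_pdivrMr ?ltr0n // mul1r ler_nat.
set q := Q eps in nQ *.
pose D : finType := {ffun 'I_q -> {ffun 'I_q -> 'I_n}}.
have cardD : #|D| = ((n ^ q) ^ q)%N by rewrite !card_ffun !card_ord.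
have nq0 : (0 < n ^ q)%N by rewrite expn_gt0 (leq_ltn_trans _ nQ).
have D0 : (0 < #|D|)%N by rewrite cardD expn_gt0 nq0.
rewrite !pr_output_draw_from //; split => [PG|farG].
  rewrite (eq_bigr (fun=> 1)) => [|F _].
    by rewrite sumr_const divff // pnatr_eq0 -lt0n.
  rewrite pr_block; suff -> : nobad n q F G by [].
  apply/ffun_onP => i; rewrite !inE; apply/asboolPn => -[k [u [hu [_]]]]; apply.
  exact: hP.
have rej : \sum_(F : D) pr_output R G false (block n q F) =
    (#|D|)%:R - (#|~: bad_tuples G q| ^ q)%:R.
  rewrite (eq_bigr (fun F => 1 - (nobad n q F G)%:R)) => [|F _]; last first.
    by rewrite pr_block; case: (nobad n q F G); rewrite ?subrr ?subr0.
  rewrite sumrB sumr_const; congr (_ - _).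
  have -> : (#|~: bad_tuples G q| ^ q = #|[pred F : D | nobad n q F G]|)%N.
    by rewrite -[X in (_ ^ X)%N](card_ord q) -card_ffun_on; apply: eq_card.
  rewrite -sum1_card natr_sum [RHS]big_mkcond /=.
  by apply: eq_bigr => F _; rewrite inE; case: (nobad n q F G).
rewrite rej ler_pdivlMr ?ltr0n //.
set b := #|bad_tuples G q|; set N := (n ^ q)%N in nq0 cardD *.
have bN : (b <= N)%N.
  by apply: leq_trans (max_card _) _; rewrite card_ffun !card_ord.
have bq : (2 * N <= q * b)%N := hQ _ eps0 _ _ nQ farG.
have -> : #|~: bad_tuples G q| = (N - b)%N.
  by rewrite cardsCs setCK card_ffun !card_ord.
rewrite cardD.
suff : (3 * (N - b) ^ q <= N ^ q)%N by rewrite -(ler_nat R) natrM; lra.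
(* Bernoulli in the form [(1 - x) ^ k * (1 + k * x) <= 1] with [x = b / N]; for [k = q], where
   [q * x >= 2], the power is at most one third. *)
have key k : (((N - b) ^ k) * (N + k * b) <= N ^ k * N)%N.
  elim: k => [|k IH]; first by rewrite !expn0; lia.
  rewrite !expnS; have : ((N - b) * (N + k.+1 * b) <= N * (N + k * b))%N by nia.
  move=> h; have := leq_mul h (leqnn ((N - b) ^ k)); have := leq_mul (leqnn N) IH; lia.
have := key q; have : (3 * N <= N + q * b)%N by lia.
move=> /(leq_mul (leqnn ((N - b) ^ q))) h1 h2.
rewrite -(leq_pmul2r nq0); lia.
Qed.

End Tester.

(** * Sending the vertices of a small graph into a large one *)

Section PointSelection.
Variables (R : realFieldType) (n N K m : nat) (pi : 'I_n -> 'I_m) (rho : 'I_N -> 'I_m).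
Hypotheses (n_gt0 : (0 < n)%N) (K_gt0 : (0 < K)%N).
Hypotheses (Kn : (2 * K <= n)%N) (nN : (2 * (K * (2 * n)) <= N)%N).

Definition block (k : nat) : {set 'I_N} := [set x | bucket K x == k].
Definition subblock (t : nat) : {set 'I_N} := [set x | bucket (K * (2 * n)) x == t].
Definition class (a : 'I_m) : {set 'I_N} := [set x | rho x == a].
Definition block_class k a : {set 'I_N} := block k :&: class a.
Definition block_of (v : 'I_n) : 'I_K := Ordinal (bucket_lt v K_gt0).
Definition class_of (v : 'I_n) : {set 'I_N} := block_class (block_of v) (pi v).

(* [j + v] ranges in a window of [n] consecutive sub-blocks out of [2 * n], so
   the position of [v] is spread over its block when [j] is random, while
   distinct vertices of a block keep their order. *)
Definition slot (j : 'I_n) (v : 'I_n) : nat := (2 * n * block_of v + j + v)%N.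

Lemma slot_lt j v : (slot j v < K * (2 * n))%N.
Proof.
have := ltn_ord j; have := ltn_ord v; have := ltn_ord (block_of v).
by rewrite /slot; move: (block_of v : nat) => k; nia.
Qed.

Lemma slot_div j v : (slot j v %/ (2 * n) = block_of v)%N.
Proof.
rewrite /slot -addnA mulnC divnMDl ?muln_gt0 // divn_small ?addn0 //.
by have := ltn_ord j; have := ltn_ord v; lia.
Qed.

(** Two vertices of a block share the offset [J], so their own order decides; in different blocks
    the slots lie in disjoint intervals of length [2 * n]. *)
Lemma slot_incr (J : 'I_K -> 'I_n) (v w : 'I_n) : (v < w)%N ->
  (slot (J (block_of v)) v < slot (J (block_of w)) w)%N.
Proof.
move=> vw; have := bucket_mono K (ltnW vw); rewrite leq_eqVlt => /orP[/eqP e|lt].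
  have eb : block_of v = block_of w by exact: val_inj.
  by rewrite /slot eb ltn_add2l.
have := ltn_ord (J (block_of v)); have := ltn_ord v.
by move: lt; rewrite /slot /=; move: (bucket K v) (bucket K w) => k l; nia.
Qed.

Lemma subblock_sub j v : subblock (slot j v) \subset block (block_of v).
Proof.
apply/subsetP => x; rewrite !inE => /eqP e.
by rewrite -(slot_div j v) -e bucket_div // muln_gt0.
Qed.

Lemma card_subblock j v : N%:R <= 4 * n%:R * K%:R * #|subblock (slot j v)|%:R :> R.
Proof.
have [+ _] := card_bucket (slot_lt j v) nN; rewrite -(ler_nat R) => h.
by apply: (le_trans h); rewrite !natrM /subblock; lra.
Qed.

Lemma card_block v : K%:R * #|block (block_of v)|%:R <= 2 * N%:R :> R.
Proof.
have KN : (2 * K <= N)%N by nia.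
have [_] := card_bucket (ltn_ord (block_of v)) KN.
by rewrite -(ler_nat R) !natrM.
Qed.

(** * Good positions and the ranges of candidate points *)

Variable tau : R.
Hypotheses (tau_gt0 : 0 < tau) (tau_le1 : tau <= 1).

Definition frequent (v : 'I_n) : bool := tau * #|block (block_of v)|%:R <= #|class_of v|%:R.

(** With denominators cleared: the density of the class in the sub-block is at least half its
    density in the block. *)
Definition typical (j : 'I_n) (v : 'I_n) : bool :=
  #|subblock (slot j v)|%:R * #|class_of v|%:R <=
  2 * #|subblock (slot j v) :&: class (pi v)|%:R * #|block (block_of v)|%:R :> R.

Definition good (j v : 'I_n) : bool := frequent v && typical j v.

(** In a position that is not good, the class is given up and the whole sub-block is allowed; the
    order is preserved in both cases. *)
Definition range (j v : 'I_n) : {set 'I_N} :=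
  if good j v then subblock (slot j v) :&: class (pi v) else subblock (slot j v).

Lemma range_sub j v : range j v \subset subblock (slot j v).
Proof. by rewrite /range; case: ifP => // _; exact: subsetIl. Qed.

Lemma block_gt0 v : 0 < #|block (block_of v)|%:R :> R.
Proof.
have N0 : 0 < N%:R :> R by rewrite ltr0n; nia.
have sb := card_subblock (Ordinal n_gt0) v.
have := subset_leq_card (subblock_sub (Ordinal n_gt0) v); rewrite -(ler_nat R) => h.
rewrite lt_neqAle ler0n andbT eq_sym; move: (lt_le_trans N0 sb); apply: contraTneq => e.
rewrite e in h; have : #|subblock (slot (Ordinal n_gt0) v)|%:R = 0 :> R.
  by apply: le_anti; rewrite h ler0n.
by move=> ->; rewrite mulr0 -leNgt.
Qed.

Lemma card_range j v : tau * N%:R <= 8 * n%:R * K%:R * #|range j v|%:R.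
Proof.
have sb := card_subblock j v; have nK : 0 <= n%:R * K%:R :> R by rewrite mulr_ge0.
have h : tau * #|subblock (slot j v)|%:R <= 2 * #|range j v|%:R.
  rewrite /range; case: ifP => [/andP[f t]|_]; last first.
    have := ler_wpM2r (ler0n R #|subblock (slot j v)|) tau_le1.
    by have := ler0n R #|subblock (slot j v)|; lra.
  rewrite -(ler_pM2r (block_gt0 v)); apply: le_trans t; rewrite -mulrA [_ * #|block _|%:R]mulrC mulrA.
  have := ler_wpM2l (ler0n _ #|subblock (slot j v)|) f; rewrite /=; lra.
have := ler_wpM2l nK h; have := ler_wpM2l (ltW tau_gt0) sb; lra.
Qed.

Lemma range_gt0 j v : 0 < #|range j v|%:R :> R.
Proof.
have N0 : 0 < N%:R :> R by rewrite ltr0n; nia.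
have := lt_le_trans (mulr_gt0 tau_gt0 N0) (card_range j v).
by rewrite !ltr0n lt0n; apply: contraTneq => ->; rewrite mulr0 ltxx.
Qed.

(** The class keeps half its density in a sub-block, which is about a [1 / (2 * n)] part of the
    block; two roundings in [card_bucket] cost a factor 2 each. *)
Lemma card_good_range j v : good j v -> #|class_of v|%:R <= 16 * n%:R * #|range j v|%:R :> R.
Proof.
move=> gd; rewrite /range gd; case/andP: gd => f t.
have sb := card_subblock j v; have bb := card_block v.
have N0 : 0 < N%:R :> R by rewrite ltr0n; nia.
rewrite -(ler_pM2l N0); move: t.
rewrite /typical; set D : R := #|_ :&: _|%:R; set C : R := #|class_of v|%:R.
set S : R := #|subblock _|%:R in sb *; set B : R := #|block _|%:R in bb *.
move=> t; have C0 : 0 <= C by []; have D0 : 0 <= D by [].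
have n0 : 0 <= n%:R :> R by []; have K0 : 0 <= K%:R :> R by [].
have h1 := ler_wpM2r C0 sb; have h2 := ler_wpM2l (mulr_ge0 n0 K0) t.
have h3 := ler_wpM2l (mulr_ge0 n0 D0) bb; lra.
Qed.

Definition mass (j v : 'I_n) (x : 'I_N) : R := (x \in range j v)%:R / #|range j v|%:R.

Lemma mass_ge0 j v x : 0 <= mass j v x.
Proof. by rewrite divr_ge0. Qed.

Lemma sum_mass j v : \sum_x mass j v x = 1.
Proof.
rewrite -mulr_suml -natr_sum -big_mkcond sum1_card divff // gt_eqF ?range_gt0 //.
Qed.

(** Averaged over the window, a point in good position has at most 16 times the uniform density on
    [class_of v]: the sub-blocks for distinct [j] are disjoint, so at most one term is nonzero. *)
Lemma sum_good_mass v x :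
  \sum_j (good j v)%:R * mass j v x <=
  16 * n%:R * ((x \in class_of v)%:R / #|class_of v|%:R).
Proof.
have term j : (good j v)%:R * mass j v x <= (x \in subblock (slot j v))%:R *
    (16 * n%:R * ((x \in class_of v)%:R / #|class_of v|%:R)).
  case: (boolP (good j v)) => gd; last by rewrite mul0r !mulr_ge0 ?invr_ge0.
  rewrite mul1r /mass; case: (boolP (x \in range j v)) => xr; last first.
    by rewrite mul0r !mulr_ge0 ?invr_ge0.
  have xs := subsetP (range_sub j v) _ xr.
  have xc : x \in class_of v.
    move: xr; rewrite /range gd !inE => /andP[_ ->]; rewrite andbT.
    by have := subsetP (subblock_sub j v) _ xs; rewrite inE.
  rewrite xs xc !mul1r -[leLHS]mul1r ler_pdivrMr ?range_gt0 // mulrAC ler_pdivlMr.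
    by rewrite mul1r card_good_range.
  by rewrite ltr0n; apply/card_gt0P; exists x.
apply: (le_trans (ler_sum _ (fun j _ => term j))); rewrite -mulr_suml.
apply: ler_piMl; first by rewrite !mulr_ge0 ?invr_ge0.
rewrite -natr_sum -[leRHS]/(1%:R) ler_nat -big_mkcond sum1_card.
have mem j : x \in subblock (slot j v) -> bucket (K * (2 * n)) x = slot j v.
  by rewrite inE => /eqP.
apply/card_le1_eqP => i j h1 h2; have := mem i h1; rewrite (mem j h2).
by rewrite /slot => /addIn/addnI/val_inj.
Qed.

Lemma sum_mass_le j v x : tau * N%:R * mass j v x <= 8 * n%:R * K%:R.
Proof.
rewrite /mass; case: (x \in _); last by rewrite mul0r mulr0 !mulr_ge0.
by rewrite mulrA mulr1 ler_pdivrMr ?range_gt0 // card_range.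
Qed.

Lemma sum_blocks (f : 'I_n -> R) :
  \sum_(k < K) \sum_(v | block_of v == k) f v = \sum_v f v.
Proof. by rewrite [RHS](partition_big block_of xpredT). Qed.

Lemma card_block_of (k : nat) : (k < K)%N ->
  K%:R * #|[set v : 'I_n | bucket K v == k]|%:R <= 2 * n%:R :> R.
Proof. by move=> kK; have [_] := card_bucket kK Kn; rewrite -(ler_nat R) !natrM. Qed.

(** * Rarity of positions that are not good *)

Variables (beta epsA epsB epsI sigma C1 : R).
Hypotheses (beta_ge0 : 0 <= beta) (sigma_ge0 : 0 <= sigma) (C1_ge0 : 0 <= C1).
Hypothesis profile : forall (k : 'I_K) a,
  #|[set v | (block_of v == k) && (pi v == a)]|%:R * N%:R <=
  n%:R * (#|block_class k a|%:R + beta * N%:R) :> R.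

Let N_gt0 : 0 < N%:R :> R. Proof. by rewrite ltr0n; nia. Qed.
Let nR_gt0 : 0 < n%:R :> R. Proof. by rewrite ltr0n. Qed.
Let KR_gt0 : 0 < K%:R :> R. Proof. by rewrite ltr0n. Qed.

(** A class infrequent in a block fills at most [2 * tau / K] of the large graph, hence by [profile]
    at most [beta] more of the small one; there are [K * m] pairs of a block and a class. *)
Lemma sum_infrequent :
  \sum_v (~~ frequent v)%:R <= n%:R * (2 * tau * m%:R + K%:R * m%:R * beta).
Proof.
rewrite (partition_big (fun v => (block_of v, pi v)) xpredT) //=.
have -> : n%:R * (2 * tau * m%:R + K%:R * m%:R * beta) =
    \sum_(ka : 'I_K * 'I_m) n%:R * (2 * tau / K%:R + beta) :> R.
  rewrite sumr_const card_prod !card_ord -[RHS]mulr_natr natrM; field.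
  by rewrite gt_eqF.
apply: ler_sum => -[k a] _.
case: (pickP [pred v | ((block_of v, pi v) == (k, a)) && ~~ frequent v]) => [v0|none]; last first.
  rewrite big1 => [|v e]; last by have := none v; rewrite /= e /= => ->.
  by rewrite mulr_ge0 // addr_ge0 // divr_ge0 // mulr_ge0 // ltW.
move=> /= /andP[/eqP[e1 e2]]; rewrite /frequent -ltNge /class_of e1 e2 => lt.
apply: (@le_trans _ _ #|[set v | (block_of v == k) && (pi v == a)]|%:R).
  rewrite -sum1_card natr_sum [leRHS]big_mkcond [leLHS]big_mkcond /=.
  by apply: ler_sum => v _; rewrite inE xpair_eqE; case: ifP => // _; rewrite lern1 leq_b1.
rewrite -(ler_pM2r N_gt0); apply: le_trans (profile k a) _; rewrite -[leRHS]mulrA ler_wpM2l //.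
rewrite mulrDl lerD2r; apply: le_trans (ltW lt) _.
have := card_block v0; rewrite e1 => h.
rewrite -(ler_pM2l KR_gt0).
have -> : K%:R * (2 * tau / K%:R * N%:R) = tau * (2 * N%:R) by field; rewrite gt_eqF.
by have := ler_wpM2l (ltW tau_gt0) h; lra.
Qed.

Definition indicator (a : 'I_m) (x : 'I_N) : R := (rho x == a)%:R.
Definition deviation (a : 'I_m) (x : 'I_N) : R :=
  cexp (bucket (K * (2 * n)) : 'I_N -> nat) (indicator a) x -
  cexp (bucket K : 'I_N -> nat) (indicator a) x.
Hypothesis deviation_small : \sum_a \sum_x deviation a x ^+ 2 <= epsB * N%:R.

Lemma cexp_indicator M a x :
  cexp (bucket M : 'I_N -> nat) (indicator a) x =
  #|[set y : 'I_N | bucket M y == bucket M x] :&: class a|%:R / #|[set y : 'I_N | bucket M y == bucket M x]|%:R.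
Proof.
rewrite /cexp /cell; congr (_ / _); rewrite -sum1_card natr_sum big_mkcond [RHS]big_mkcond /=.
by apply: eq_bigr => y _; rewrite !inE /indicator; case: (bucket M y == _); case: (rho y == a).
Qed.

(** The density is at least [tau] on the block and less than half as large on the sub-block, so it
    deviates by at least [tau / 2]. *)
Lemma deviation_atypical j v x : frequent v -> ~~ typical j v ->
  x \in subblock (slot j v) -> tau ^+ 2 <= 4 * deviation (pi v) x ^+ 2.
Proof.
move=> f; rewrite /typical -ltNge => lt xs.
have xb := subsetP (subblock_sub j v) _ xs.
rewrite /deviation !cexp_indicator.
have -> : [set y : 'I_N | bucket (K * (2 * n)) y == bucket (K * (2 * n)) x] = subblock (slot j v).
  by apply/setP => y; move: xs; rewrite !inE => /eqP ->.
have -> : [set y : 'I_N | bucket K y == bucket K x] = block (block_of v).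
  by apply/setP => y; move: xb; rewrite !inE => /eqP ->.
rewrite -/(block_class (block_of v) (pi v)) -/(class_of v).
have S0 : 0 < #|subblock (slot j v)|%:R :> R by rewrite ltr0n; apply/card_gt0P; exists x.
have B0 := block_gt0 v.
have h1 : tau <= #|class_of v|%:R / #|block (block_of v)|%:R by rewrite ler_pdivlMr.
have h2 : 2 * (#|subblock (slot j v) :&: class (pi v)|%:R / #|subblock (slot j v)|%:R) <=
   #|class_of v|%:R / #|block (block_of v)|%:R :> R.
  rewrite ler_pdivlMr // [2 * _]mulrA mulrAC ler_pdivrMr //; lra.
set p := #|class_of v|%:R / _ in h1 h2 *; set q := _ / #|subblock _|%:R in h2 *.
have h : tau <= 2 * (p - q) by lra.
by have := ler_pM (ltW tau_gt0) (ltW tau_gt0) h h; lra.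
Qed.

Lemma sum_subblocks v (f : 'I_N -> R) : (forall x, 0 <= f x) ->
  \sum_j \sum_(x in subblock (slot j v)) f x <= \sum_(x in block (block_of v)) f x.
Proof.
move=> f0.
rewrite (exchange_big_dep (mem (block (block_of v)))) /=; last first.
  by move=> j x _; exact: subsetP (subblock_sub j v) x.
apply: ler_sum => x _; rewrite sumr_const -mulr_natr; apply: ler_piMr => //.
rewrite -[leRHS]/(1%:R) ler_nat.
have mem j : x \in subblock (slot j v) -> bucket (K * (2 * n)) x = slot j v.
  by rewrite inE => /eqP.
apply/card_le1_eqP => i j h1 h2; have := mem i h1; rewrite (mem j h2).
by rewrite /slot => /addIn/addnI/val_inj.
Qed.

(** Chebyshev: every point of an atypical sub-block has squared deviation at least [tau ^+ 2 / 4].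
    The sub-blocks of one [v] are disjoint, and a block holds at most [2 * n / K] vertices [v]. *)
Lemma sum_atypical :
  tau ^+ 2 * \sum_v \sum_j (frequent v && ~~ typical j v)%:R <= 32 * n%:R ^+ 2 * epsB.
Proof.
pose dev2 x : R := \sum_a deviation a x ^+ 2.
have dev2_ge0 x : 0 <= dev2 x by apply: sumr_ge0 => a _; exact: sqr_ge0.
have one v : tau ^+ 2 * N%:R * \sum_j (frequent v && ~~ typical j v)%:R <=
    16 * n%:R * K%:R * \sum_(x in block (block_of v)) dev2 x.
  apply: le_trans (ler_wpM2l _ (sum_subblocks v dev2_ge0)); last by rewrite !mulr_ge0.
  rewrite !mulr_sumr; apply: ler_sum => j _.
  case: (boolP (_ && _)) => [/andP[f t]|_]; last first.
    by rewrite mulr0 !mulr_ge0 // sumr_ge0.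
  have h : tau ^+ 2 * #|subblock (slot j v)|%:R <= 4 * \sum_(x in subblock (slot j v)) dev2 x.
    rewrite mulr_natr -sumr_const mulr_sumr; apply: ler_sum => x xs.
    apply: le_trans (deviation_atypical f t xs) _; rewrite ler_wpM2l //.
    rewrite /dev2 (bigD1 (pi v)) //= lerDl sumr_ge0 // => a _; exact: sqr_ge0.
  have h1 := ler_wpM2l (sqr_ge0 tau) (card_subblock j v).
  have h2 := ler_wpM2l (mulr_ge0 (ltW nR_gt0) (ltW KR_gt0)) h.
  move: h1 h2; rewrite mulr1; lra.
have two : (\sum_v \sum_(x in block (block_of v)) dev2 x) * K%:R <= 2 * n%:R * (epsB * N%:R).
  rewrite mulr_suml; under eq_bigr do rewrite mulr_suml.
  apply: (@le_trans _ _ (2 * n%:R * \sum_x dev2 x)); last first.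
    by rewrite ler_wpM2l ?mulr_ge0 // /dev2 exchange_big.
  rewrite (exchange_big_dep xpredT) //= mulr_sumr; apply: ler_sum => x _.
  rewrite sumr_const -[leLHS]mulr_natr -mulrA [leLHS]mulrC ler_wpM2r //.
  have := card_block_of (bucket_lt x K_gt0); apply: le_trans.
  rewrite ler_wpM2l // ler_nat; apply: subset_leq_card; apply/subsetP => v.
  move=> h; have : x \in block (block_of v) := h.
  by rewrite !inE eq_sym.
have three : tau ^+ 2 * N%:R * \sum_v \sum_j (frequent v && ~~ typical j v)%:R <=
    16 * n%:R * K%:R * \sum_v \sum_(x in block (block_of v)) dev2 x.
  by rewrite mulr_sumr [leRHS]mulr_sumr; apply: ler_sum => v _; exact: one.
rewrite -(ler_pM2r N_gt0).
set s1 := \sum_v \sum_j _ in three *; set s2 := \sum_v _ in two three *.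
have := ler_wpM2l (ltW nR_gt0) two; lra.
Qed.

Lemma sum_not_good : \sum_v \sum_j (~~ good j v)%:R <=
  n%:R ^+ 2 * (2 * tau * m%:R + K%:R * m%:R * beta + 32 * epsB / tau ^+ 2).
Proof.
have t2 : 0 < tau ^+ 2 by rewrite exprn_gt0.
apply: (@le_trans _ _ (\sum_v \sum_(j < n) (~~ frequent v)%:R +
    \sum_v \sum_j (frequent v && ~~ typical j v)%:R)).
  rewrite -big_split; apply: ler_sum => v _; rewrite -big_split; apply: ler_sum => j _ /=.
  by rewrite /good; case: frequent; case: typical; rewrite /= ?addr0 ?add0r.
rewrite mulrDr lerD //.
  have -> : \sum_v \sum_(j < n) (~~ frequent v)%:R = (\sum_v (~~ frequent v)%:R) * n%:R :> R.
    by rewrite mulr_suml; apply: eq_bigr => v _; rewrite sumr_const card_ord mulr_natr.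
  rewrite expr2 -mulrA [leRHS]mulrC ler_wpM2r //; exact: sum_infrequent.
rewrite mulrA ler_pdivlMr // mulrC; apply: le_trans sum_atypical _; lra.
Qed.

(** * Mean cost of pairs, and the choice of windows and points *)

Variables (g : 'I_N -> 'I_N -> R) (irr : rel 'I_N).
Hypotheses (g_ge0 : forall x y, 0 <= g x y) (g_le : forall x y, g x y <= sigma).
Hypothesis g_small : \sum_x \sum_y g x y <= epsA * N%:R ^+ 2.
Hypothesis irr_small : \sum_x \sum_y (irr x y)%:R <= epsI * N%:R ^+ 2.
Hypothesis theta_le1 : beta * (K%:R * m%:R) <= 1.

Definition share (v : 'I_n) (x : 'I_N) : R := (x \in class_of v)%:R / #|class_of v|%:R.

Definition position (x : 'I_N) : 'I_K * 'I_m := (Ordinal (bucket_lt x K_gt0), rho x).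

(** The sum of shares counts the small-graph vertices in the block and class of [x], divided by the
    size of the corresponding cell; [profile] compares the two. *)
Lemma sum_share x :
  N%:R * \sum_v share v x <= n%:R * (1 + beta * (N%:R / #|cell position x|%:R)).
Proof.
have cellE : cell position x = block_class (position x).1 (position x).2.
  by apply/setP => y; rewrite !inE /position xpair_eqE.
have -> : \sum_v share v x =
    #|[set v | (block_of v == (position x).1) && (pi v == (position x).2)]|%:R / #|cell position x|%:R.
  rewrite -sum1_card natr_sum mulr_suml [RHS]big_mkcond /=; apply: eq_bigr => v _.
  rewrite /share cellE !inE.
  case: (boolP ((block_of v == (position x).1) && (pi v == (position x).2))) => [/andP[/eqP e1 /eqP e2]|no].
    by rewrite /class_of e1 e2 /= !eqxx.
  suff -> : (bucket K x == block_of v) && (rho x == pi v) = false by rewrite mul0r.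
  apply: contraNF no => /andP[/eqP e1 /eqP e2].
  by rewrite /= e2 eqxx andbT; apply/eqP/val_inj; rewrite /= e1.
have c0 : 0 < #|cell position x|%:R :> R by exact: cellR_gt0.
rewrite mulrA ler_pdivrMr // mulrC; apply: le_trans (profile _ _) _; rewrite -cellE.
rewrite le_eqVlt; apply/orP; left; apply/eqP; field; rewrite gt_eqF //.
Qed.

Lemma sum_inv_card_cell : \sum_x (#|cell position x|%:R)^-1 <= K%:R * m%:R :> R.
Proof.
rewrite (partition_big position xpredT) //=.
have -> : K%:R * m%:R = \sum_(t : 'I_K * 'I_m) 1 :> R.
  by rewrite sumr_const card_prod !card_ord natrM.
apply: ler_sum => t _.
case: (pickP [pred x | position x == t]) => [x0 /= /eqP e|none]; last by rewrite big_pred0.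
rewrite (eq_bigr (fun=> (#|cell position x0|%:R)^-1)) => [|x /eqP ex]; last first.
  by rewrite /cell ex e.
rewrite sumr_const -[leLHS]mulr_natr mulrC.
have -> : #|[pred x | position x == t]| = #|cell position x0|.
  by apply: eq_card => x; rewrite !inE e.
by rewrite divff // gt_eqF // cellR_gt0.
Qed.

(** The summed shares exceed the uniform density [n / N] by at most the relative amount [h x], of
    mean at most [theta]. The uniform part costs [epsA]; each of [h x], [h y] and [h x * h y] costs
    at most [sigma * theta], since [theta <= 1]. *)
Lemma sum_share2 : \sum_x \sum_y (\sum_v share v x) * (\sum_w share w y) * g x y <=
  n%:R ^+ 2 * (epsA + 3 * sigma * (beta * (K%:R * m%:R))).
Proof.
pose h x := beta * (N%:R / #|cell position x|%:R).
have h0 x : 0 <= h x by rewrite mulr_ge0 // divr_ge0.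
pose theta := beta * (K%:R * m%:R); have theta1 : theta <= 1 := theta_le1; rewrite -/theta.
have hsum : \sum_x h x <= theta * N%:R.
  rewrite /h -mulr_sumr /theta -mulrA ler_wpM2l // -mulr_sumr mulrC ler_wpM2r //.
  exact: sum_inv_card_cell.
have hsum0 : 0 <= \sum_x h x by exact: sumr_ge0.
have share0 x : 0 <= \sum_v share v x by apply: sumr_ge0 => v _; rewrite divr_ge0.
rewrite -(ler_pM2l (mulr_gt0 N_gt0 N_gt0)).
apply: (@le_trans _ _ (\sum_x \sum_y n%:R ^+ 2 * (g x y + sigma * (h x + h y + h x * h y)))).
  rewrite mulr_sumr; apply: ler_sum => x _; rewrite mulr_sumr; apply: ler_sum => y _.
  have := ler_pM (mulr_ge0 (ltW N_gt0) (share0 x)) (mulr_ge0 (ltW N_gt0) (share0 y)) (sum_share x) (sum_share y).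
  rewrite -/(h x) -/(h y); set s1 := \sum_v _; set s2 := \sum_v _ => le.
  have e1 : N%:R * N%:R * (s1 * s2 * g x y) = N%:R * s1 * (N%:R * s2) * g x y by ring.
  rewrite e1; apply: le_trans (ler_wpM2r (g_ge0 x y) le) _.
  have := ler_wpM2l (mulr_ge0 (mulr_ge0 (ltW nR_gt0) (ltW nR_gt0))
     (addr_ge0 (addr_ge0 (h0 x) (h0 y)) (mulr_ge0 (h0 x) (h0 y)))) (g_le x y).
  lra.
set S := \sum_x h x in hsum hsum0 *.
have hE : \sum_x \sum_y (h x + h y + h x * h y) = S * N%:R + S * N%:R + S * S.
  have row x : \sum_y (h x + h y + h x * h y) = h x * N%:R + S + h x * S.
    by rewrite [h x * S]mulr_sumr !big_split /= sumr_const card_ord mulr_natr.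
  under eq_bigr do rewrite row.
  by rewrite [S * S]mulr_suml !big_split /= -mulr_suml sumr_const card_ord mulr_natr.
have -> : \sum_x \sum_y n%:R ^+ 2 * (g x y + sigma * (h x + h y + h x * h y)) =
    n%:R ^+ 2 * (\sum_x \sum_y g x y + sigma * (S * N%:R + S * N%:R + S * S)).
  rewrite -hE [sigma * _]mulr_sumr -big_split mulr_sumr; apply: eq_bigr => x _.
  by rewrite /= [sigma * _]mulr_sumr -big_split mulr_sumr.
have n2 : 0 <= n%:R ^+ 2 :> R by exact: sqr_ge0.
have theta0 : 0 <= theta by rewrite mulr_ge0 // mulr_ge0.
have SS : S * S <= theta * (N%:R * N%:R).
  apply: le_trans (ler_pM hsum0 hsum0 hsum hsum) _.
  have := ler_wpM2r (mulr_ge0 theta0 (mulr_ge0 (ltW N_gt0) (ltW N_gt0))) theta1; lra.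
have SN := ler_wpM2r (ltW N_gt0) hsum.
have T : S * N%:R + S * N%:R + S * S <= 3 * theta * (N%:R * N%:R) by lra.
have := ler_wpM2l sigma_ge0 T => T2.
rewrite [leRHS]mulrCA ler_wpM2l //; move: g_small T2; lra.
Qed.

Let pair_cost (v w : 'I_n) (i j : 'I_n) : R :=
  (good i v && good j w)%:R * \sum_x \sum_y mass i v x * mass j w y * g x y.

Lemma pair_cost_ge0 v w i j : 0 <= pair_cost v w i j.
Proof.
rewrite mulr_ge0 // sumr_ge0 // => x _; rewrite sumr_ge0 // => y _.
by rewrite mulr_ge0 // mulr_ge0 ?mass_ge0.
Qed.

(** Each of the two ends contributes the factor 16 of [sum_good_mass]. *)
Lemma mean_pair_cost v w :
  \sum_i \sum_j n%:R^-1 * n%:R^-1 * pair_cost v w i j <=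
  256 * \sum_x \sum_y share v x * share w y * g x y.
Proof.
have -> : \sum_i \sum_j n%:R^-1 * n%:R^-1 * pair_cost v w i j =
    \sum_x \sum_y (n%:R^-1 * \sum_i (good i v)%:R * mass i v x) *
      (n%:R^-1 * \sum_j (good j w)%:R * mass j w y) * g x y.
  transitivity (\sum_x \sum_y \sum_i \sum_j (n%:R^-1 * ((good i v)%:R * mass i v x)) *
      (n%:R^-1 * ((good j w)%:R * mass j w y)) * g x y); last first.
    apply: eq_bigr => x _; apply: eq_bigr => y _.
    rewrite [X in X * _ * _]mulr_sumr !mulr_suml; apply: eq_bigr => i _.
    by rewrite [X in _ * X * _]mulr_sumr mulr_sumr mulr_suml.
  rewrite [RHS](eq_bigr (fun x => \sum_i \sum_j \sum_y (n%:R^-1 * ((good i v)%:R * mass i v x)) *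
      (n%:R^-1 * ((good j w)%:R * mass j w y)) * g x y)); last first.
    by move=> x _; rewrite exchange_big; apply: eq_bigr => i _; rewrite exchange_big.
  rewrite [RHS]exchange_big; apply: eq_bigr => i _; rewrite [RHS]exchange_big; apply: eq_bigr => j _ /=.
  rewrite /pair_cost !mulr_sumr; apply: eq_bigr => x _; rewrite !mulr_sumr; apply: eq_bigr => y _.
  by rewrite -mulnb natrM; ring.
rewrite mulr_sumr; apply: ler_sum => x _; rewrite mulr_sumr; apply: ler_sum => y _.
have h u z : n%:R^-1 * (\sum_i (good i u)%:R * mass i u z) <= 16 * share u z.
  rewrite mulrC ler_pdivrMr //; apply: le_trans (sum_good_mass u z) _.
  by rewrite -/(share u z); lra.
have h0 u z : 0 <= n%:R^-1 * (\sum_i (good i u)%:R * mass i u z).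
  by rewrite mulr_ge0 ?invr_ge0 // sumr_ge0 // => i _; rewrite mulr_ge0 ?mass_ge0.
have := ler_wpM2r (g_ge0 x y) (ler_pM (h0 v x) (h0 w y) (h v x) (h w y)); lra.
Qed.

(** Windows are drawn uniformly and independently for the blocks. Only pairs in different blocks are
    charged, so that their two windows are independent. *)
Lemma choose_windows : exists J : {ffun 'I_K -> 'I_n},
  n%:R * \sum_v (~~ good (J (block_of v)) v)%:R +
  C1 * \sum_v \sum_(w | block_of v != block_of w)
    pair_cost v w (J (block_of v)) (J (block_of w)) <=
  n%:R ^+ 2 * (2 * tau * m%:R + K%:R * m%:R * beta + 32 * epsB / tau ^+ 2 +
    256 * C1 * (epsA + 3 * sigma * (beta * (K%:R * m%:R)))).
Proof.
have p0 (k : 'I_K) (j : 'I_n) : 0 <= n%:R^-1 :> R by rewrite invr_ge0.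
have p1 (k : 'I_K) : \sum_(j : 'I_n) n%:R^-1 = 1 :> R.
  by rewrite sumr_const card_ord -[LHS]mulr_natr mulVf // gt_eqF.
have [J [_ hJ]] := exists_le_average p0 p1
  (fun k j => \sum_(v | block_of v == k) n%:R * (~~ good j v)%:R)
  (fun k l i j => \sum_(v | block_of v == k) \sum_(w | block_of w == l) C1 * pair_cost v w i j).
exists J; move: hJ.
have -> : \sum_k \sum_(v | block_of v == k) n%:R * (~~ good (J k) v)%:R =
    n%:R * \sum_v (~~ good (J (block_of v)) v)%:R :> R.
  rewrite mulr_sumr -[RHS]sum_blocks; apply: eq_bigr => k _.
  by apply: eq_bigr => v /eqP ->.
have -> : \sum_k \sum_(l | k != l) \sum_(v | block_of v == k) \sum_(w | block_of w == l)
     C1 * pair_cost v w (J k) (J l) =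
    C1 * \sum_v \sum_(w | block_of v != block_of w) pair_cost v w (J (block_of v)) (J (block_of w)).
  rewrite mulr_sumr -[RHS]sum_blocks; apply: eq_bigr => k _.
  rewrite exchange_big; apply: eq_bigr => v /eqP ev /=.
  rewrite mulr_sumr [RHS](partition_big block_of (fun l => k != l)) /= => [|w]; last by rewrite ev.
  apply: eq_bigr => l kl; apply: eq_big => [w|w /eqP ew]; last by rewrite ev ew.
  by case: eqP => [->|]; rewrite ?andbF // ev kl.
move=> hJ; apply: (le_trans hJ); rewrite mulrDr lerD //.
  apply: le_trans sum_not_good.
  rewrite [leRHS](_ : _ = \sum_k \sum_(v | block_of v == k) \sum_j (~~ good j v)%:R); last first.
    by rewrite sum_blocks.
  apply: ler_sum => k _; rewrite le_eqVlt; apply/orP; left; apply/eqP.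
  under eq_bigr do rewrite mulr_sumr.
  rewrite exchange_big /=; apply: eq_bigr => v _; apply: eq_bigr => j _.
  by rewrite mulrA mulVf ?mul1r // gt_eqF.
apply: (@le_trans _ _ (C1 * \sum_v \sum_w 256 * \sum_x \sum_y share v x * share w y * g x y)); last first.
  have -> : C1 * (\sum_v \sum_w 256 * \sum_x \sum_y share v x * share w y * g x y) =
      256 * C1 * (\sum_x \sum_y (\sum_v share v x) * (\sum_w share w y) * g x y).
    rewrite [256 * C1]mulrC -mulrA; congr (_ * _).
    under eq_bigr do rewrite -mulr_sumr; rewrite -mulr_sumr; congr (_ * _).
    under eq_bigr do rewrite exchange_big.
    rewrite exchange_big; apply: eq_bigr => x _ /=.
    under eq_bigr do rewrite exchange_big.
    rewrite exchange_big; apply: eq_bigr => y _ /=.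
    rewrite !mulr_suml; apply: eq_bigr => v _.
    by rewrite mulr_sumr mulr_suml.
  by rewrite mulrCA ler_wpM2l ?sum_share2 // mulr_ge0.
apply: (@le_trans _ _ (\sum_k \sum_l \sum_(v | block_of v == k) \sum_(w | block_of w == l)
   C1 * \sum_i \sum_j n%:R^-1 * n%:R^-1 * pair_cost v w i j)).
  apply: ler_sum => k _; rewrite big_mkcond /=; apply: ler_sum => l _.
  case: ifP => _; last first.
    apply: sumr_ge0 => v _; apply: sumr_ge0 => w _; rewrite mulr_ge0 // sumr_ge0 // => i _.
    rewrite sumr_ge0 // => j _; apply: mulr_ge0 (pair_cost_ge0 _ _ _ _).
    by rewrite mulr_ge0 ?invr_ge0.
  rewrite le_eqVlt; apply/orP; left; apply/eqP.
  rewrite [RHS](eq_bigr (fun v => \sum_i \sum_j \sum_(w | block_of w == l)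
     n%:R^-1 * n%:R^-1 * (C1 * pair_cost v w i j))); last first.
    move=> v _; under [LHS]eq_bigr do rewrite mulr_sumr.
    rewrite exchange_big; apply: eq_bigr => i _; under [LHS]eq_bigr do rewrite mulr_sumr.
    rewrite exchange_big; apply: eq_bigr => j _; apply: eq_bigr => w _.
    by rewrite mulrCA.
  rewrite [RHS]exchange_big; apply: eq_bigr => i _; rewrite [RHS]exchange_big; apply: eq_bigr => j _.
  by rewrite mulr_sumr; apply: eq_bigr => v _; rewrite mulr_sumr.
have -> : \sum_k \sum_l \sum_(v | block_of v == k) \sum_(w | block_of w == l)
   C1 * (\sum_i \sum_j n%:R^-1 * n%:R^-1 * pair_cost v w i j) =
   C1 * \sum_v \sum_w \sum_i \sum_j n%:R^-1 * n%:R^-1 * pair_cost v w i j.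
  rewrite mulr_sumr -[RHS]sum_blocks; apply: eq_bigr => k _.
  rewrite exchange_big; apply: eq_bigr => v _ /=.
  by rewrite mulr_sumr -[RHS]sum_blocks.
rewrite ler_wpM2l //; apply: ler_sum => v _; apply: ler_sum => w _; exact: mean_pair_cost.
Qed.

Let total : R := 2 * tau * m%:R + K%:R * m%:R * beta + 32 * epsB / tau ^+ 2 +
  256 * C1 * (epsA + 3 * sigma * (beta * (K%:R * m%:R))) +
  64 * n%:R ^+ 4 * K%:R ^+ 2 / tau ^+ 2 * epsI.

(** With the windows fixed, points are drawn independently and uniformly from their ranges. In [F] a
    pair in [irr] is charged [n ^+ 2]; as the mean cost is below [n ^+ 2], the chosen points span no
    such pair. *)
Lemma choose_points : total < 1 ->
  exists (y : {ffun 'I_n -> 'I_N}) (ok : pred 'I_n),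
  [/\ forall v w : 'I_n, (v < w)%N -> (bucket (K * (2 * n)) (y v) < bucket (K * (2 * n)) (y w))%N,
      forall v w, v != w -> ~~ irr (y v) (y w),
      forall v, ok v -> rho (y v) = pi v &
      n%:R * (\sum_v (~~ ok v)%:R) + C1 * (\sum_v \sum_(w | block_of v != block_of w)
        (ok v && ok w)%:R * g (y v) (y w)) <= n%:R ^+ 2 * total].
Proof.
move=> tot1; have [J hJ] := choose_windows.
pose p v := mass (J (block_of v)) v; pose ok v := good (J (block_of v)) v.
pose F v w x y : R := C1 * ((block_of v != block_of w) && (ok v && ok w))%:R * g x y +
   n%:R ^+ 2 * (irr x y)%:R.
have [y [py hy]] := exists_le_average (fun v => mass_ge0 (J (block_of v)) v)
  (fun v => sum_mass (J (block_of v)) v) (fun _ _ => 0) F.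
have split2 (q : 'I_n -> 'I_n -> R) (z : 'I_n -> 'I_n -> bool) :
    \sum_v \sum_(w | v != w) ((block_of v != block_of w) && z v w)%:R * q v w =
    \sum_v \sum_(w | block_of v != block_of w) (z v w)%:R * q v w.
  apply: eq_bigr => v _; rewrite big_mkcond [RHS]big_mkcond; apply: eq_bigr => w _ /=.
  case: (eqVneq v w) => [->|_] /=; first by rewrite eqxx.
  by case: (block_of v == block_of w); rewrite /= ?mul0r.
(* This concerns also pairs inside a block and positions that are not good, so the pointwise bound
   [sum_mass_le] replaces averaging over windows; its powers of [n] are absorbed by taking [epsI]
   small in terms of [n]. *)
have irrbound : \sum_v \sum_(w | v != w) \sum_x \sum_y p v x * p w y * (n%:R ^+ 2 * (irr x y)%:R) <=
    n%:R ^+ 2 * (64 * n%:R ^+ 4 * K%:R ^+ 2 / tau ^+ 2 * epsI).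
  have tN : 0 < tau * N%:R by rewrite mulr_gt0.
  have one v w : \sum_x \sum_y p v x * p w y * (n%:R ^+ 2 * (irr x y)%:R) <=
      64 * n%:R ^+ 4 * K%:R ^+ 2 / tau ^+ 2 * epsI.
    have T0 : 0 < tau * N%:R * (tau * N%:R) by rewrite mulr_gt0.
    rewrite -(ler_pM2l T0).
    apply: (@le_trans _ _ (\sum_x \sum_y (64 * n%:R ^+ 4 * K%:R ^+ 2) * (irr x y)%:R)).
      rewrite mulr_sumr; apply: ler_sum => x _; rewrite mulr_sumr; apply: ler_sum => z _.
      have := ler_pM (mulr_ge0 (ltW tN) (mass_ge0 _ _ _)) (mulr_ge0 (ltW tN) (mass_ge0 _ _ _))
        (sum_mass_le (J (block_of v)) v x) (sum_mass_le (J (block_of w)) w z) => h.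
      have := ler_wpM2r (mulr_ge0 (sqr_ge0 n%:R) (ler0n R (irr x z))) h; rewrite -/(p v) -/(p w); lra.
    under eq_bigr do rewrite -mulr_sumr; rewrite -mulr_sumr.
    have -> : tau * N%:R * (tau * N%:R) * (64 * n%:R ^+ 4 * K%:R ^+ 2 / tau ^+ 2 * epsI) =
        64 * n%:R ^+ 4 * K%:R ^+ 2 * (epsI * N%:R ^+ 2) by field; rewrite gt_eqF.
    by rewrite ler_wpM2l // !mulr_ge0 // exprn_ge0.
  have e0 : 0 <= 64 * n%:R ^+ 4 * K%:R ^+ 2 / tau ^+ 2 * epsI.
    have : 0 <= epsI * N%:R ^+ 2.
      by apply: le_trans irr_small; apply: sumr_ge0 => x _; apply: sumr_ge0.
    rewrite pmulr_lge0 ?exprn_gt0 // => e0.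
    by rewrite !mulr_ge0 ?invr_ge0 ?exprn_ge0 // ltW.
  apply: (@le_trans _ _ (\sum_(v < n) \sum_(w < n) 64 * n%:R ^+ 4 * K%:R ^+ 2 / tau ^+ 2 * epsI)).
    apply: ler_sum => v _; rewrite big_mkcond /=; apply: ler_sum => w _; case: ifP => _; [exact: one | exact: e0].
  by rewrite !sumr_const !card_ord -mulrnA -[leLHS]mulr_natl natrM expr2.
move: hy; rewrite big1 // add0r [X in _ <= X + _]big1 => [|v _]; last by apply: big1 => x _; rewrite mulr0.
rewrite add0r.
have -> : \sum_v \sum_(w | v != w) \sum_x \sum_z p v x * p w z * F v w x z =
   C1 * (\sum_v \sum_(w | block_of v != block_of w) pair_cost v w (J (block_of v)) (J (block_of w))) +
   \sum_v \sum_(w | v != w) \sum_x \sum_z p v x * p w z * (n%:R ^+ 2 * (irr x z)%:R).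
  rewrite -(split2 _ (fun v w => ok v && ok w)) mulr_sumr -big_split; apply: eq_bigr => v _ /=.
  rewrite mulr_sumr -big_split; apply: eq_bigr => w _ /=.
  rewrite !mulr_sumr -big_split; apply: eq_bigr => x _ /=.
  rewrite !mulr_sumr -big_split; apply: eq_bigr => z _ /=.
  by rewrite /F /p /ok; ring.
have -> : \sum_v \sum_(w | v != w) F v w (y v) (y w) =
   C1 * (\sum_v \sum_(w | block_of v != block_of w) (ok v && ok w)%:R * g (y v) (y w)) +
   n%:R ^+ 2 * \sum_v \sum_(w | v != w) (irr (y v) (y w))%:R.
  rewrite -(split2 _ (fun v w => ok v && ok w)) !mulr_sumr -big_split; apply: eq_bigr => v _ /=.
  rewrite !mulr_sumr -big_split; apply: eq_bigr => w _ /=.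
  by rewrite /F mulrA.
move=> hy.
have yrange v : y v \in range (J (block_of v)) v.
  by have := py v; rewrite /mass; case: (_ \in _); rewrite // mul0r ltxx.
have yslot v : bucket (K * (2 * n)) (y v) = slot (J (block_of v)) v.
  by have := subsetP (range_sub (J (block_of v)) v) _ (yrange v); rewrite inE => /eqP.
have bad0 : 0 <= n%:R * \sum_v (~~ ok v)%:R :> R by rewrite mulr_ge0 // sumr_ge0.
have g0 : 0 <= C1 * (\sum_v \sum_(w | block_of v != block_of w) (ok v && ok w)%:R * g (y v) (y w)).
  rewrite mulr_ge0 // sumr_ge0 // => v _; rewrite sumr_ge0 // => w _; exact: mulr_ge0.
have all : n%:R * (\sum_v (~~ ok v)%:R) + (C1 * (\sum_v \sum_(w | block_of v != block_of w)
    (ok v && ok w)%:R * g (y v) (y w)) + n%:R ^+ 2 * \sum_v \sum_(w | v != w) (irr (y v) (y w))%:R)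
   <= n%:R ^+ 2 * total.
  by rewrite /total [leRHS]mulrDr; move: hJ hy irrbound; rewrite -/ok; lra.
have n2 : 0 < n%:R ^+ 2 :> R by rewrite exprn_gt0.
have irr0 : 0 <= n%:R ^+ 2 * \sum_v \sum_(w | v != w) (irr (y v) (y w))%:R :> R.
  by rewrite mulr_ge0 ?(ltW n2) // sumr_ge0 // => v _; exact: sumr_ge0.
exists y, ok; split.
- by move=> v w vw; rewrite !yslot slot_incr.
- move=> v w vw; apply/negP => ir.
  have : n%:R ^+ 2 * total < n%:R ^+ 2 * 1 by rewrite ltr_pM2l.
  have : n%:R ^+ 2 * 1 <= n%:R ^+ 2 * \sum_v \sum_(w | v != w) (irr (y v) (y w))%:R :> R.
    rewrite ler_wpM2l ?(ltW n2) // (bigD1 v) //= (bigD1 w) //= ir -addrA lerDl.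
    by rewrite addr_ge0 // sumr_ge0 // => u _; exact: sumr_ge0.
  lra.
- move=> v okv; have := yrange v; rewrite /range -/(ok v) okv !inE => /andP[_ /eqP].
  exact.
- by lra.
Qed.

End PointSelection.

(** * Colors as oriented relations *)

Section Adjacency.
Variables (Sigma : finType) (n : nat) (G : ograph Sigma n).

(** Oriented from the smaller to the larger vertex: an edge of any color certifies the order of its
    ends, which makes embedded copies increasing. *)
Definition adj (c : Sigma) (x y : 'I_n) : bool :=
  [exists p : vpair n, (sval p == (x, y)) && (G p == c)].

Lemma adj_pair c (p : vpair n) : adj c (sval p).1 (sval p).2 = (G p == c).
Proof.
apply/existsP/idP => [[p' /andP[/eqP e]]|Gp].
  suff -> : p' = p by [].
  by apply: val_inj; rewrite /= e; case: (sval p).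
by exists p; rewrite Gp andbT -surjective_pairing.
Qed.

Lemma adj_lt c x y : adj c x y -> (x < y)%N.
Proof.
case/existsP => p /andP[/eqP e _]; have := svalP p; rewrite /= in e *.
by rewrite e.
Qed.

Lemma adj_ex (x y : 'I_n) : (x < y)%N -> exists c, adj c x y.
Proof.
move=> xy; pose p : vpair n := exist _ (x, y) xy.
by exists (G p); rewrite (adj_pair _ p).
Qed.

Lemma adj_uniq c c' x y : adj c x y -> adj c' x y -> c = c'.
Proof.
case/existsP => p /andP[/eqP e /eqP <-].
by have := adj_pair c' p; rewrite e /= => -> /eqP.
Qed.

Lemma sum_adj (R : realFieldType) (x y : 'I_n) : (x < y)%N -> \sum_c (adj c x y)%:R = 1 :> R.
Proof.
move=> /adj_ex[c xy]; rewrite (bigD1 c) //= xy big1 ?addr0 // => c' c'c.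
by case: (boolP (adj c' x y)) => // /(adj_uniq xy) e; rewrite e eqxx in c'c.
Qed.

(** Stored as a set of labels, so that graphs of different sizes can be compared and pigeonholed. *)
Definition dense_triples (R : realFieldType) (eta : R) (m : nat) (pi : 'I_n -> 'I_m) :
    {set 'I_m * 'I_m * Sigma} :=
  [set t | [exists x, exists y, [&& pi x == t.1.1, pi y == t.1.2 &
    eta <= dens R adj pi t.2 x y]]].

Lemma dense_triplesP (R : realFieldType) (eta : R) (m : nat) (pi : 'I_n -> 'I_m) c x y :
  ((pi x, pi y, c) \in dense_triples eta pi) = (eta <= dens R adj pi c x y).
Proof.
rewrite inE; apply/existsP/idP => [[x' /existsP[y' /and3P[/eqP ex /eqP ey]]]|h]; last first.
  by exists x; apply/existsP; exists y; rewrite !eqxx.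
rewrite /dens (@cexp_eq _ _ _ _ _ (x, y) (x', y')) // inE /pair_label /=.
by move: ex ey => /= -> ->.
Qed.

End Adjacency.

(** * Modification of the small graph guided by the large one *)

Section Repair.
Variables (R : realFieldType) (Sigma : finType) (P : ograph_property Sigma).
Variables (n N K m : nat) (G : ograph Sigma n) (Gs : ograph Sigma N).
Variables (pi : 'I_n -> 'I_m) (rho : 'I_N -> 'I_m) (L : finType) (W : 'I_N -> L).
Variables (eta kappa b : R).
Hypotheses (K_gt0 : (0 < K)%N) (Kn : (2 * K <= n)%N) (n_gt1 : (1 < n)%N).
Hypotheses (eta_gt0 : 0 < eta) (eta_le : eta / 2 * #|Sigma|%:R < 1) (eta_le1 : eta <= 1).
Hypotheses (kappa_gt0 : 0 < kappa) (kappa_le : kappa * n%:R <= (eta / 4) ^+ n) (b_gt0 : 0 < b).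
Hypothesis W_fine : forall x y, W x = W y -> bucket (K * (2 * n)) x = bucket (K * (2 * n)) y.
Hypothesis same_triples : dense_triples G eta pi = dense_triples Gs eta rho.
Hypothesis few_bad : (#|bad_tuples P Gs n|%:R < kappa ^+ n * (b * N%:R) ^+ n).

Definition density_gap (x y : 'I_N) : R :=
  \sum_c (dens R (adj Gs) W c x y - dens R (adj Gs) rho c x y) ^+ 2.
(** Small cells are excluded as well, because the counting lemma measures copies against the product
    of the cell sizes. *)
Definition exceptional (x y : 'I_N) : bool :=
  [|| irregular (adj Gs) W kappa (eta / 4) x y,
      #|cell W x|%:R < b * N%:R | #|cell W y|%:R < b * N%:R].

Variables (y : {ffun 'I_n -> 'I_N}) (ok : pred 'I_n).
Hypothesis y_incr : forall v w : 'I_n, (v < w)%N ->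
  (bucket (K * (2 * n)) (y v) < bucket (K * (2 * n)) (y w))%N.
Hypothesis y_regular : forall v w, v != w -> ~~ exceptional (y v) (y w).
Hypothesis y_ok : forall v, ok v -> rho (y v) = pi v.

Let d c (v w : 'I_n) : R := dens R (adj Gs) W c (y v) (y w).

(** A color is changed only when it is sparse between the [W]-cells of the images; [repair_dense]
    shows that [pick] then succeeds. *)
Definition repair : ograph Sigma n :=
  [ffun p => if eta / 2 <= d (G p) (sval p).1 (sval p).2 then G p
             else odflt (G p) [pick c | eta / 2 <= d c (sval p).1 (sval p).2]].

(** As [W] refines the sub-blocks, the two cells lie entirely in the right order, and each pair
    between them has exactly one color. *)
Lemma sum_d (v w : 'I_n) : (v < w)%N -> \sum_c d c v w = 1.
Proof.
move=> vw; rewrite /d; under eq_bigr do rewrite densE.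
rewrite -mulr_suml.
have -> : \sum_c edge_sum R (adj Gs c) (cell W (y v)) (cell W (y w)) =
   #|cell W (y v)|%:R * #|cell W (y w)|%:R.
  rewrite exchange_big /=.
  under eq_bigr do rewrite exchange_big.
  rewrite (eq_bigr (fun=> #|cell W (y w)|%:R)) => [|x xv]; last first.
    rewrite -sum1_card natr_sum; apply: eq_bigr => z zw; apply: sum_adj.
    rewrite ltnNge; apply/negP => /(bucket_mono (K * (2 * n))); rewrite leqNgt => /negP; apply.
    move: xv zw; rewrite !inE => /eqP/W_fine -> /eqP/W_fine ->; exact: y_incr.
  by rewrite sumr_const mulr_natl.
by rewrite divff // mulf_neq0 // gt_eqF // cellR_gt0.
Qed.

Lemma repair_dense (p : vpair n) : eta / 2 <= d (repair p) (sval p).1 (sval p).2.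
Proof.
rewrite ffunE; case: ifP => // _; case: pickP => //= none.
have := sum_d (svalP p); have S0 : (0 < #|Sigma|)%N by apply/card_gt0P; exists (G p).
move=> e; suff : (1 : R) < 1 by rewrite ltxx.
apply: le_lt_trans eta_le; rewrite -[leLHS]e mulr_natr -sumr_const; apply: ler_sum => c _.
by apply: ltW; rewrite ltNge none.
Qed.

(** Otherwise every copy of [repair] in [Gs] is a bad [n]-tuple, and the counting lemma in the cells
    of the images gives more copies than [few_bad] allows. *)
Lemma repair_in : P repair.
Proof.
apply: contrapT => nP.
pose E (i j : 'I_n) : rel 'I_N := fun x z =>
  [exists p : vpair n, (sval p == (i, j)) && adj Gs (repair p) x z].
have n0 : (0 < n)%N by exact: ltnW.
have reg (i j : 'I_n) : (i < j)%N ->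
    @lower_regular R _ kappa (eta / 4) (E i j) (cell W (y i)) (cell W (y j)).
  move=> ij; pose p : vpair n := exist _ (i, j) ij.
  have EE : E i j =2 adj Gs (repair p).
    move=> x z; apply/existsP/idP => [[p' /andP[/eqP e]]|h]; last by exists p; rewrite h andbT.
    by suff -> : p' = p by []; apply: val_inj.
  have /norP[/regularP r _] := y_regular (negbT (ltn_eqF ij)).
  move=> A B sA sB kA kB; have := r (repair p) A B sA sB kA kB.
  have -> : edge_sum R (adj Gs (repair p)) A B = edge_sum R (E i j) A B.
    by apply: eq_bigr => x _; apply: eq_bigr => z _; rewrite EE.
  (* Density at least [eta / 2], less the regularity defect [eta / 4], leaves [eta / 4]. *)
  apply: le_trans; rewrite ler_wpM2r ?mulr_ge0 //.
  have := repair_dense p; rewrite /d /=; lra.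
have d1 : eta / 4 <= 1 by clear reg; move: eta_le1; lra.
have d0 : 0 < eta / 4 by rewrite divr_gt0.
have cnt := @card_embeddings R _ _ E (fun i j : 'I_n => (i < j)%N) kappa (eta / 4)
  (fun i => cell W (y i)) kappa_gt0 d0 d1 reg (enum 'I_n) 1 (fun i => cell W (y i)) y.
have : kappa ^+ n * \prod_(i <- enum 'I_n) #|cell W (y i)|%:R <=
    #|embeddings E (enum 'I_n) (fun i => cell W (y i)) y|%:R :> R.
  have := cnt; rewrite size_enum_ord; apply=> //.
  - exact: enum_uniq.
  - have := iota_ltn_sorted 0 n; rewrite -val_enum_ord sorted_pairwise ?pairwise_map //.
    exact: ltn_trans.
  - by move=> i _; rewrite mul1r.
  - by rewrite mul1r.
rewrite big_enum /= => cnt2; move: few_bad; rewrite ltNge => /negP; apply.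
apply: (@le_trans _ _ (kappa ^+ n * \prod_(i < n) #|cell W (y i)|%:R)).
  rewrite ler_wpM2l ?exprn_ge0 ?(ltW kappa_gt0) //.
  have -> : (b * N%:R) ^+ n = \prod_(i < n) (b * N%:R) by rewrite prodr_const card_ord.
  apply: ler_prod => i _; rewrite mulr_ge0 ?(ltW b_gt0) //=.
  (* Cell sizes are controlled only through pairs that are not exceptional, so a second vertex is
     required. *)
  have [j ij] : exists j : 'I_n, i != j.
    case: (eqVneq i (Ordinal n0)) => [->|ne]; last by exists (Ordinal n0).
    by exists (Ordinal n_gt1).
  by have /norP[_ /norP[]] := y_regular ij; rewrite -leNgt.
apply: (le_trans cnt2); rewrite ler_nat; apply: subset_leq_card; apply/subsetP => f.
rewrite !inE => /and3P[_ _ fE].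
have fp (p : vpair n) : adj Gs (repair p) (f (sval p).1) (f (sval p).2).
  have h : pairwise (fun i j : 'I_n => E i j (f i) (f j)) (enum 'I_n) := fE.
  have lt := svalP p.
  have := pairwiseP (sval p).1 h (val (sval p).1) (val (sval p).2).
  rewrite !inE size_enum_ord !ltn_ord => /(_ isT isT lt); rewrite !nth_ord_enum.
  case/existsP => p' /andP[/eqP e]; suff -> : p' = p by [].
  by apply: val_inj; rewrite /= e; case: (sval p).
have finc : increasing f.
  move=> i j ij; pose p : vpair n := exist _ (i, j) ij; exact: adj_lt (fp p).
apply/asboolP; exists n, f, finc; split; first by move=> i; exists i.
suff -> : induced Gs finc = repair by [].
apply/ffunP => p; rewrite ffunE; have := fp p; rewrite (adj_pair Gs _ (vpair_map finc p)).
by move/eqP.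
Qed.

Variables (C1 total : R).
Hypothesis C1E : C1 = 4 / eta ^+ 2.
Hypothesis y_cost : n%:R * (\sum_v (~~ ok v)%:R) +
  C1 * \sum_v \sum_(w | block_of K_gt0 v != block_of K_gt0 w)
    (ok v && ok w)%:R * density_gap (y v) (y w) <= n%:R ^+ 2 * total.

(** A changed pair has one of four causes: [f1], its color is sparse between its classes in [G];
    [f2], its ends share a block; [f3], an end is not [ok]; [f4], the color is dense between the
    classes in [Gs] but sparse between the [W]-cells. *)
Lemma repair_cost : (edit_distance G repair)%:R <=
  n%:R ^+ 2 * (#|Sigma|%:R * eta + 2 / K%:R + 2 * total).
Proof.
have n0 : (0 < n)%N by exact: ltnW.
have gap_ge0 x z : 0 <= density_gap x z by apply: sumr_ge0 => c _; exact: sqr_ge0.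
have C1_gt0 : 0 < C1 by rewrite C1E divr_gt0 ?exprn_gt0.
pose f1 v w : R := \sum_c (adj G c v w)%:R * ((pi v, pi w, c) \notin dense_triples G eta pi)%:R.
pose f2 (v w : 'I_n) : R := (block_of K_gt0 v == block_of K_gt0 w)%:R.
pose f3 (v w : 'I_n) : R := (~~ ok v)%:R + (~~ ok w)%:R.
pose f4 (v w : 'I_n) : R := C1 * ((block_of K_gt0 v != block_of K_gt0 w)%:R *
    ((ok v && ok w)%:R * density_gap (y v) (y w))).
have f10 v w : 0 <= f1 v w by apply: sumr_ge0 => c _; exact: mulr_ge0.
have f40 v w : 0 <= f4 v w.
  by apply: mulr_ge0; [exact: ltW | apply: mulr_ge0 => //; exact: mulr_ge0].
pose f v w := f1 v w + f2 v w + f3 v w + f4 v w.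
have f0 v w : 0 <= f v w by rewrite /f !addr_ge0.
have edit_le : (edit_distance G repair)%:R <= \sum_v \sum_w f v w.
  rewrite pair_big /= /edit_distance -(card_imset _ val_inj) -sum1_card natr_sum.
  set D := [set _ | _ in _].
  rewrite [leRHS](bigID (mem D)) /= -[leLHS]addr0 lerD //; last by apply: sumr_ge0.
  apply: ler_sum => _ /imsetP[p + ->]; rewrite inE => Gp /=.
  have low : d (G p) (sval p).1 (sval p).2 < eta / 2.
    by rewrite ltNge; apply/negP => h; move: Gp; rewrite ffunE h eqxx.
  move: (sval p).1 (sval p).2 (adj_pair G (G p) p) low => v w; rewrite eqxx => vw low.
  have g1 := f10 v w; have g4 := f40 v w; rewrite /f.
  have g2 : 0 <= f2 v w by []. have g3 : 0 <= f3 v w by rewrite /f3 addr_ge0.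
  case: (boolP ((pi v, pi w, G p) \in dense_triples G eta pi)) => [inZ|notZ]; last first.
    have : 1 <= f1 v w.
      by rewrite /f1 (bigD1 (G p)) //= vw notZ mulr1 lerDl sumr_ge0 // => c _; exact: mulr_ge0.
    lra.
  case: (boolP (ok v)) => okv; last first.
    have : 1 <= f3 v w by rewrite /f3 okv lerDl. lra.
  case: (boolP (ok w)) => okw; last first.
    have : 1 <= f3 v w by rewrite /f3 okw lerDr. lra.
  case: (boolP (block_of K_gt0 v == block_of K_gt0 w)) => bl.
    have : 1 <= f2 v w by rewrite /f2 bl. lra.
  suff : 1 <= f4 v w by lra.
  rewrite /f4 bl okv okw /= !mul1r.
  have hi : eta <= dens R (adj Gs) rho (G p) (y v) (y w).
    by rewrite -dense_triplesP -same_triples !y_ok.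
  (* The density drops from at least [eta] to below [eta / 2]; [C1] is the inverse square of this
     drop. *)
  have sq : eta ^+ 2 / 4 <= density_gap (y v) (y w).
    rewrite /density_gap (bigD1 (G p)) //=.
    apply: ler_wpDr; first by apply: sumr_ge0 => c _; exact: sqr_ge0.
    move: low hi; rewrite /d; set d1 := dens _ _ _ _ _ _; set d2 := dens _ _ _ _ _ _ => low hi.
    have h : eta / 2 <= d2 - d1 by lra.
    have h0 : 0 <= eta / 2 by rewrite divr_ge0 // ltW.
    by have := ler_pM h0 h0 h h; lra.
  apply: le_trans (ler_wpM2l (ltW C1_gt0) sq); rewrite C1E.
  have -> : 4 / eta ^+ 2 * (eta ^+ 2 / 4) = 1 by field; rewrite gt_eqF.
  exact: lexx.
apply: (le_trans edit_le).
(* Averaging over pairs of classes replaces the indicator of a color by its density, which is below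
   [eta] on sparse triples. *)
have s1 : \sum_v \sum_w f1 v w <= n%:R ^+ 2 * (#|Sigma|%:R * eta).
  under eq_bigr do rewrite exchange_big; rewrite exchange_big /=.
  apply: (@le_trans _ _ (\sum_(c : Sigma) n%:R ^+ 2 * eta)); last first.
    by rewrite sumr_const -[leLHS]mulr_natl; lra.
  apply: ler_sum => c _.
  rewrite pair_big /=.
  rewrite -[leLHS](@sum_cexpM _ _ _ (pair_label pi) (edge_fun R (adj G) c)
     (fun p => ((pi p.1, pi p.2, c) \notin dense_triples G eta pi)%:R)); last first.
    by move=> p q [-> ->].
  apply: (@le_trans _ _ (\sum_(p : 'I_n * 'I_n) eta)); last first.
    by rewrite sumr_const card_prod card_ord -[leLHS]mulr_natl natrM expr2.
  apply: ler_sum => -[v w] _; rewrite dense_triplesP -ltNge /dens /=.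
  case: ltP => h; rewrite ?mulr1 ?mulr0 ?ltW //.
have s2 : \sum_v \sum_w f2 v w <= n%:R ^+ 2 * (2 / K%:R).
  have K0 : 0 < K%:R :> R by rewrite ltr0n.
  apply: (@le_trans _ _ (\sum_(v < n) 2 * n%:R / K%:R)); last first.
    by rewrite sumr_const card_ord -[leLHS]mulr_natl; lra.
  apply: ler_sum => v _; rewrite ler_pdivlMr // mulrC.
  apply: le_trans (card_block_of R Kn (ltn_ord (block_of K_gt0 v))).
  rewrite ler_wpM2l // -sum1_card natr_sum [leRHS]big_mkcond /=; apply: ler_sum => w _.
  rewrite inE /f2; case: (eqVneq (block_of K_gt0 v) (block_of K_gt0 w)) => [e|_] /=.
    by have /= -> := congr1 val e; rewrite eqxx.
  by case: ifP.
have s3 : \sum_v \sum_w f3 v w = 2 * (n%:R * \sum_v (~~ ok v)%:R).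
  rewrite /f3; under eq_bigr do rewrite big_split /= sumr_const card_ord.
  rewrite big_split /= sumr_const card_ord sumrMnl -[_ *+ n]mulr_natl; lra.
have s4 : \sum_v \sum_w f4 v w = C1 * \sum_v \sum_(w | block_of K_gt0 v != block_of K_gt0 w)
    (ok v && ok w)%:R * density_gap (y v) (y w).
  rewrite mulr_sumr; apply: eq_bigr => v _; rewrite mulr_sumr [RHS]big_mkcond /=.
  apply: eq_bigr => w _; rewrite /f4; case: ifP => _; rewrite ?mul1r ?mul0r ?mulr0 //.
have -> : \sum_v \sum_w f v w = \sum_v \sum_w f1 v w + \sum_v \sum_w f2 v w +
    \sum_v \sum_w f3 v w + \sum_v \sum_w f4 v w.
  by rewrite -!big_split; apply: eq_bigr => v _; rewrite -!big_split.
have bad0 : 0 <= n%:R * \sum_v (~~ ok v)%:R :> R by rewrite mulr_ge0 // sumr_ge0.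
have g0 : 0 <= \sum_v \sum_w f4 v w by apply: sumr_ge0 => v _; exact: sumr_ge0.
move: s1 s2 y_cost g0; rewrite s3 s4; lra.
Qed.

End Repair.

(** * Stable partitions along a sequence of graphs *)

Definition color_gap (R : realFieldType) (Sigma : finType) (n : nat) (G : ograph Sigma n)
    (L L' : eqType) (l : 'I_n -> L) (l' : 'I_n -> L') : R :=
  \sum_c \sum_p (cexp (pair_label l') (edge_fun R (adj G) c) p -
                 cexp (pair_label l) (edge_fun R (adj G) c) p) ^+ 2.

Section GraphSequence.
Variables (R : realType) (Sigma : finType) (nn : nat -> nat).
Variable GG : forall q, ograph Sigma (nn q).
Hypothesis nn_gt : forall q, (q < nn q)%N.

Let nnR_gt0 q : 0 < (nn q)%:R :> R.
Proof. by rewrite ltr0n (leq_ltn_trans _ (nn_gt q)). Qed.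

Lemma energy_kernel (X : finType) (K K' : eqType) (l : X -> K) (l' : X -> K') (f : X -> R) :
  refines l l' -> refines l' l -> energy l f = energy l' f.
Proof.
move=> h h'; apply: eq_bigr => x _; congr (_ ^+ 2); rewrite /cexp.
suff -> : cell l x = cell l' x by [].
by apply/setP => y; rewrite !inE; apply/eqP/eqP => [/h|/h'].
Qed.

Lemma refines_pair (X : finType) (K K' : eqType) (l : X -> K) (l' : X -> K') :
  refines l l' -> refines (pair_label l) (pair_label l').
Proof. by move=> h [x y] [x' y'] [/h e /h e']; rewrite /pair_label /= e e'. Qed.

(** The energy of all colors, divided by the number of ordered pairs, is at most [#|Sigma|], so
    [stabilize] applies; by [energy_gain], a small gain means that densities hardly change in mean
    square. *)
Lemma stabilize_labels (eps : R) (A0 : nat -> Prop) (T0 : finType)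
    (l0 : forall q, 'I_(nn q) -> T0) :
  0 < eps -> infinite_set A0 ->
  exists (A : nat -> Prop) (m : nat) (l : forall q, 'I_(nn q) -> 'I_m.+1),
  [/\ infinite_set A, forall q, A q -> A0 q, forall q, A q -> refines (l q) (l0 q) &
      forall M, exists N0, forall q, (N0 <= q)%N -> A q ->
        forall (T : finType) (l' : 'I_(nn q) -> T), (#|T| <= M)%N -> refines l' (l q) ->
          color_gap R (GG q) (l q) l' <= eps * (nn q)%:R ^+ 2].
Proof.
move=> eps0 infA0.
(* Natural numbers as labels put refinements with arbitrary finite label types into one type; the
   complexity bounds the labels. *)
pose X q := 'I_(nn q) -> nat.
pose ref q (x y : X q) := refines y x.
pose cx q (x : X q) := (\max_i (x i).+1)%N.
pose en q (x : X q) : R :=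
  (\sum_c energy (pair_label x) (edge_fun R (adj (GG q)) c)) / (nn q)%:R ^+ 2.
have nn2 q : 0 < (nn q)%:R ^+ 2 :> R by rewrite exprn_gt0.
pose nat_label q (T : finType) (l : 'I_(nn q) -> T) : X q := fun i => enum_rank (l i).
have nat_labelK q (T : finType) (l : 'I_(nn q) -> T) : refines (nat_label q T l) l /\ refines l (nat_label q T l).
  by split=> [x y /val_inj/enum_rank_inj|x y e] //; rewrite /nat_label e.
have cx_nat q (T : finType) (l : 'I_(nn q) -> T) : (cx q (nat_label q T l) <= #|T|)%N.
  by apply/bigmax_leqP => i _; exact: ltn_ord.
have en_bound q (x : X q) : A0 q -> 0 <= en q x <= #|Sigma|%:R.
  move=> _; rewrite /en divr_ge0 ?(ltW (nn2 q)) ?sumr_ge0 //=; last by move=> c _; exact: energy_ge0.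
  rewrite ler_pdivrMr // mulr_natl -sumr_const; apply: ler_sum => c _.
  apply: le_trans (energy_le _ _) _ => [p|]; first by rewrite /edge_fun ler0n lern1 leq_b1.
  by rewrite card_prod card_ord natrM expr2.
have ref_refl q (x : X q) : ref q x x by [].
have ref_trans q (x y z : X q) : ref q x y -> ref q y z -> ref q x z.
  by move=> h h' i j /h'/h.
have [A [x [M [infA subA xM stab]]]] := stabilize ref_refl ref_trans eps0 en_bound infA0
  (fun q _ => cx_nat q T0 (l0 q)).
(* For [q] in [A] all labels are below [M], so [inord] identifies none of them. *)
exists A, M, (fun q i => inord (x q i)).
have lK q : A q -> refines (fun i => inord (x q i) : 'I_M.+1) (x q).
  move=> Aq i j /(congr1 val) /=; have [_ c] := xM q Aq.
  have lt k : (x q k < M.+1)%N.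
    by apply: leq_trans (leqnSn _); apply: leq_trans c; exact: (leq_bigmax k).
  by rewrite !inordK.
split => //.
- by move=> q Aq i j /(lK q Aq)/(proj1 (xM q Aq))/(proj1 (nat_labelK q _ (l0 q))).
- move=> M'; have [N0 hN0] := stab M'; exists N0 => q N0q Aq T l' cT ref'.
  have lK' : refines (x q) (fun i => inord (x q i) : 'I_M.+1) by move=> i j ->.
  have [k1 k2] := nat_labelK q T l'.
  have ref2 : ref q (x q) (nat_label q T l') by move=> i j /k1/ref'/(lK q Aq).
  have := hN0 q N0q Aq (nat_label q T l') ref2 (leq_trans (cx_nat _ _ _) cT).
  rewrite -lerBlDl /en -mulrBl ler_pdivrMr // -sumrB; apply: le_trans.
  rewrite /color_gap; apply: ler_sum => c _; rewrite energy_gain; last exact: refines_pair.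
  rewrite (energy_kernel _ (refines_pair k2) (refines_pair k1)).
  by rewrite (energy_kernel _ (refines_pair (lK q Aq)) (refines_pair lK')).
Qed.

Lemma stabilize_buckets (eps : R) (A0 : nat -> Prop) (m : nat)
    (l : forall q, 'I_(nn q) -> 'I_m) (K0 : nat) :
  0 < eps -> infinite_set A0 -> (0 < K0)%N ->
  exists (A : nat -> Prop) (K : nat),
  [/\ infinite_set A, forall q, A q -> A0 q, (K0 <= K)%N &
      forall d, (0 < d)%N -> exists N0, forall q, (N0 <= q)%N -> A q ->
        \sum_a \sum_x (cexp (bucket (K * d) : 'I_(nn q) -> nat) (indicator R (l q) a) x -
          cexp (bucket K : 'I_(nn q) -> nat) (indicator R (l q) a) x) ^+ 2 <= eps * (nn q)%:R].
Proof.
move=> eps0 infA0 K00.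
(* The index [k] stands for [k.+1] buckets, so that their number is positive; divisibility makes the
   buckets nested. *)
pose ref (q : nat) (x y : nat) : Prop := (x.+1 %| y.+1)%N.
pose en q (k : nat) : R :=
  (\sum_a energy (bucket k.+1 : 'I_(nn q) -> nat) (indicator R (l q) a)) / (nn q)%:R.
have en_bound q (x : nat) : A0 q -> 0 <= en q x <= m%:R.
  move=> _; rewrite /en divr_ge0 ?sumr_ge0 //=; last by move=> c _; exact: energy_ge0.
  rewrite ler_pdivrMr // mulr_natl -[X in _ *+ X](card_ord m) -sumr_const; apply: ler_sum => a _.
  apply: le_trans (energy_le _ _) _ => [p|]; first by rewrite /indicator ler0n lern1 leq_b1.
  by rewrite card_ord.
have ref_refl q (x : nat) : ref q x x by exact: dvdnn.
have ref_trans q (x y z : nat) : ref q x y -> ref q y z -> ref q x z by exact: dvdn_trans.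
have [A [k [M [infA subA kM stab]]]] := @stabilize R (fun=> nat) ref (fun _ => id) en ref_refl
  ref_trans m%:R eps A0 (fun=> K0.-1) K0 eps0 en_bound infA0 (fun q _ => leq_pred K0).
(* The number of buckets varies with [q] but is bounded, so it is constant on an infinite subset. *)
have [k0 infB] := pigeonhole_infinite (fun q => inord (k q) : 'I_M.+1) infA.
have kE q : A q /\ (inord (k q) : 'I_M.+1) = k0 -> k q = k0.
  by case=> Aq /(congr1 val) /=; rewrite inordK // ltnS; case: (kM q Aq).
exists (fun q => A q /\ (inord (k q) : 'I_M.+1) = k0), k0.+1; split => //.
- by move=> q [/subA].
- have [q _ Bq] := infB 0%N; have [] := kM q (proj1 Bq); rewrite (kE q Bq) /ref prednK // => dv _.
  exact: dvdn_leq.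
- move=> d d0; have [N0 hN0] := stab (k0.+1 * d).-1; exists N0 => q N0q Bq.
  have := hN0 q N0q (proj1 Bq) (k0.+1 * d).-1; rewrite (kE q Bq) /ref prednK ?muln_gt0 //.
  move=> /(_ (dvdn_mulr _ (dvdnn _)) (leqnn _)).
  rewrite -lerBlDl /en -mulrBl prednK ?muln_gt0 // ler_pdivrMr // -sumrB; apply: le_trans.
  apply: ler_sum => a _; rewrite energy_gain // => x y e.
  by rewrite -(bucket_div _ _ d0) e bucket_div.
Qed.

End GraphSequence.

(** * Bounds on exceptional pairs and density gaps *)

Section Estimates.
Variables (R : realFieldType) (Sigma : finType) (N : nat) (Gs : ograph Sigma N).

Lemma card_small_cells (L : finType) (W : 'I_N -> L) (s : R) : 0 <= s ->
  \sum_x (#|cell W x|%:R < s)%R%:R <= #|L|%:R * s :> R.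
Proof.
move=> s0; rewrite (partition_big W xpredT) //= mulr_natl -sumr_const.
apply: ler_sum => t _.
case: (pickP [pred x | (W x == t) && (#|cell W x|%:R < s)]) => [x0|none]; last first.
  by rewrite big1 // => x /eqP Wx; have := none x; rewrite /= Wx eqxx /= => ->.
move=> /= /andP[/eqP <- /ltW]; apply: le_trans.
rewrite -sum1_card natr_sum big_mkcond [leRHS]big_mkcond; apply: ler_sum => x _.
by rewrite inE; case: ifP => // _; rewrite lern1 leq_b1.
Qed.

(** Half of [epsI] pays for irregular pairs, through [irregular_gain], and a quarter for each end in
    a small cell. *)
Lemma sum_exceptional (L : finType) (W : 'I_N -> L) (eta kappa b epsI : R) :
  0 < eta -> 0 < kappa -> 0 <= b -> 0 <= epsI ->
  4 * (b * #|L|%:R) <= epsI ->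
  color_gap R Gs W (witness_label (R := R) (adj Gs) W kappa (eta / 4)) <=
    epsI / 2 * ((eta / 4) ^+ 2 * kappa ^+ 2) * N%:R ^+ 2 ->
  \sum_x \sum_y (exceptional Gs W eta kappa b x y)%:R <= epsI * N%:R ^+ 2.
Proof.
move=> eta0 kappa0 b0 epsI0 bL gap.
have D0 : 0 < (eta / 4) ^+ 2 * kappa ^+ 2 by rewrite mulr_gt0 // exprn_gt0 // divr_gt0.
have irr : \sum_x \sum_y (irregular (adj Gs) W kappa (eta / 4) x y)%:R <= epsI / 2 * N%:R ^+ 2.
  rewrite -(ler_pM2l D0).
  have := le_trans (irregular_gain (adj Gs) W (ltW kappa0) (divr_ge0 (ltW eta0) (ler0n R 4))) gap.
  rewrite -sum1_card natr_sum big_mkcond pair_big /=.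
  rewrite (eq_bigr (fun p : 'I_N * 'I_N => (irregular (adj Gs) W kappa (eta / 4) p.1 p.2)%:R)).
    by move=> h; apply: (le_trans h); lra.
  by move=> p _; rewrite inE; case: irregular.
have N0 : 0 <= N%:R :> R by [].
have small := card_small_cells W (mulr_ge0 b0 N0).
apply: (@le_trans _ _ (\sum_x \sum_y ((irregular (adj Gs) W kappa (eta / 4) x y)%:R +
   (#|cell W x|%:R < b * N%:R)%R%:R + (#|cell W y|%:R < b * N%:R)%R%:R))).
  apply: ler_sum => x _; apply: ler_sum => y _; rewrite /exceptional.
  by case: irregular; case: (_ < _); case: (_ < _); rewrite /= -!natrD ler_nat.
pose S : R := \sum_x (#|cell W x|%:R < b * N%:R)%R%:R; rewrite -/S in small.
have -> : \sum_x \sum_y ((irregular (adj Gs) W kappa (eta / 4) x y)%:R +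
    (#|cell W x|%:R < b * N%:R)%R%:R + (#|cell W y|%:R < b * N%:R)%R%:R) =
    \sum_x \sum_y (irregular (adj Gs) W kappa (eta / 4) x y)%:R + N%:R * S + N%:R * S.
  under eq_bigr do rewrite !big_split /= sumr_const card_ord.
  by rewrite !big_split /= sumrMnl sumr_const card_ord !mulr_natl.
have h1 := ler_wpM2l N0 small.
have h2 := ler_wpM2r (mulr_ge0 N0 N0) bL.
move: irr h1 h2; lra.
Qed.

Lemma sum_density_gap (L : eqType) (W : 'I_N -> L) (m : nat) (rho : 'I_N -> 'I_m) :
  \sum_x \sum_y \sum_c (dens R (adj Gs) W c x y - dens R (adj Gs) rho c x y) ^+ 2 =
  color_gap R Gs rho W.
Proof.
rewrite pair_big [RHS]exchange_big; apply: eq_bigr => -[x y] _ /=.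
exact: eq_bigr.
Qed.

Lemma sqr_density_gap_le (L L' : eqType) (W : 'I_N -> L) (rho : 'I_N -> L') x y :
  \sum_c (dens R (adj Gs) W c x y - dens R (adj Gs) rho c x y) ^+ 2 <= #|Sigma|%:R.
Proof.
rewrite -sum1_card natr_sum; apply: ler_sum => c _.
have bnd (K : eqType) (l : 'I_N -> K) : 0 <= dens R (adj Gs) l c x y <= 1.
  rewrite cexp_ge0 ?cexp_le1 // => p; by rewrite /edge_fun ?lern1 ?leq_b1.
have := bnd _ W; have := bnd _ rho.
set u := dens _ _ _ _ _ _; set v := dens _ _ _ _ _ _ => /andP[u0 u1] /andP[v0 v1].
by rewrite mulr1n; nra.
Qed.

End Estimates.

(** * Rounded frequencies and the contradiction *)

Lemma round_le (D n N c d : nat) : (0 < n)%N -> (0 < N)%N ->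
  ((D * c) %/ n = (D * d) %/ N)%N -> (D * (c * N) <= n * (D * d + N))%N.
Proof.
move=> n0 N0 e; have := ltn_ceil (D * c) n0; have := leq_divM (D * d) N.
rewrite e; move: (_ %/ N)%N => r; nia.
Qed.

Lemma bin2_ge n : (1 < n)%N -> (n * n <= 4 * 'C(n, 2))%N.
Proof.
move=> n1; have := mul_bin_diag n 1; rewrite bin1; case: n n1 => // n n1 /=; nia.
Qed.

Lemma leq_sum6 a b c d e f q : (a + b + c + d + e + f <= q)%N ->
  [/\ (a <= q)%N, (b <= q)%N, (c <= q)%N & [/\ (d <= q)%N, (e <= q)%N & (f <= q)%N]].
Proof. by move=> h; split; [lia|lia|lia|split; lia]. Qed.

Lemma ratio_lt q u v x y : (0 < x)%N -> (0 < y)%N ->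
  (u * x <= v * y -> q * v < 2 * x -> q * u < 2 * y)%N.
Proof.
move=> x0 y0 h1 h2; rewrite -(ltn_pmul2r x0).
have := leq_mul (leqnn q) h1; have : (q * v * y < 2 * x * y)%N by rewrite ltn_pmul2r.
lia.
Qed.

(** Equal roundings to multiples of [1 / D] force frequencies to differ by at most [1 / D], which is
    below [beta]. *)
Lemma profile_le (R : realType) (n N K m D : nat) (beta : R) (l : 'I_n -> 'I_m) (l' : 'I_N -> 'I_m)
    (K_gt0 : (0 < K)%N) :
  (0 < n)%N -> (0 < N)%N -> 0 < beta -> beta^-1 < D%:R ->
  [ffun ka : 'I_K * 'I_m =>
    inord ((D * #|block_class K l ka.1 ka.2|) %/ n) : 'I_D.+1] =
  [ffun ka : 'I_K * 'I_m =>
    inord ((D * #|block_class K l' ka.1 ka.2|) %/ N) : 'I_D.+1] ->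
  forall (k : 'I_K) a,
  #|[set v | (block_of K_gt0 v == k) && (l v == a)]|%:R * N%:R <=
  n%:R * (#|block_class K l' k a|%:R + beta * N%:R) :> R.
Proof.
move=> n0 N0 beta0 D_gt /ffunP eq k a.
have D0 : 0 < D%:R :> R by apply: lt_trans D_gt; rewrite invr_gt0.
have le_D M (S : {set 'I_M}) : (0 < M)%N -> ((D * #|S|) %/ M < D.+1)%N.
  move=> M0; rewrite ltnS -[X in (_ <= X)%N](mulnK D M0) leq_div2r //.
  by rewrite leq_mul2l -[X in (_ <= X)%N]card_ord max_card orbT.
have := eq (k, a); rewrite !ffunE /= => /(congr1 val) /=; rewrite !inordK ?le_D // => e.
have := round_le n0 N0 e.
have -> : block_class K l k a = [set v | (block_of K_gt0 v == k) && (l v == a)].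
  by apply/setP => v; rewrite !inE.
rewrite -(ler_nat R) !natrM natrD natrM => h.
have bD : 1 <= beta * D%:R.
  by have := ler_wpM2l (ltW beta0) (ltW D_gt); rewrite divff // gt_eqF.
rewrite -(ler_pM2l D0); apply: (le_trans h).
have nN0 : 0 <= n%:R * N%:R :> R by rewrite mulr_ge0.
have := ler_wpM2l nN0 bD; lra.
Qed.

(** The constants are fixed in the order [eta], [epsA], [m], [tau], [epsB], [K], [beta], [n],
    [epsI], [kappa], [mC], [b], [N]. Each of the six terms bounding the cost in [choose_points] is
    made at most [e / 256]. *)
Lemma bad_tuples_of_far (R : realType) (Sigma : finType) (P : ograph_property Sigma)
    (eps : R) : (0 < #|Sigma|)%N -> 0 < eps -> exists q, forall n (G : ograph Sigma n),
  (q < n)%N -> far P eps G -> (2 * n ^ q <= q * #|bad_tuples P G q|)%N.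
Proof.
move=> Sigma_gt0 eps0; apply: contrapT => no.
have ex q : exists x : {n : nat & ograph Sigma n}, [/\ (q < tag x)%N,
    far P eps (tagged x) & (q * #|bad_tuples P (tagged x) q| < 2 * tag x ^ q)%N].
  apply: contrapT => h; apply: no; exists q => n G qn farG; rewrite leqNgt; apply/negP => lt.
  by apply: h; exists (Tagged _ G).
have [X hX] := choice ex.
pose nn q := tag (X q); pose GG q : ograph Sigma (nn q) := tagged (X q).
have nn_gt q : (q < nn q)%N by case: (hX q).
have GG_far q : far P eps (GG q) by case: (hX q).
have GG_bad q : (q * #|bad_tuples P (GG q) q| < 2 * nn q ^ q)%N by case: (hX q).
move: nn GG nn_gt GG_far GG_bad => nn GG nn_gt GG_far GG_bad {X hX ex no}.
have nn0 q : (0 < nn q)%N by exact: leq_ltn_trans (nn_gt q).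
pose sg : R := #|Sigma|%:R; have sg1 : 1 <= sg by rewrite ler1n.
have sg0 : 0 < sg by lra.
have [e [e0 e1 e_eps]] : exists e : R, [/\ 0 < e, e <= 1 & e <= eps].
  exists (Num.min eps 1); rewrite ge_min lexx orbT ge_min lexx /=; split => //.
  by rewrite lt_min eps0 ltr01.
(* Over all colors, sparse triples then cost at most [e / 16]. *)
pose eta := e / (16 * sg).
have eta_sg : sg * eta = e / 16 by rewrite /eta; field; rewrite gt_eqF.
have eta0 : 0 < eta by rewrite divr_gt0 // mulr_gt0.
have eta1 : eta <= 1 by have := ler_wpM2r (ltW eta0) sg1; lra.
pose C1 := 4 / eta ^+ 2.
have C10 : 0 < C1 by rewrite divr_gt0 // exprn_gt0.
pose epsA := e / (256 * (256 * C1)).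
have epsA0 : 0 < epsA.
  by apply: divr_gt0 => //; apply: mulr_gt0 => //; apply: mulr_gt0.
have epsAE : 256 * C1 * epsA = e / 256 by rewrite /epsA; field; rewrite gt_eqF.
have inf0 : infinite_set (fun=> True) by move=> b; exists b.
have [A1 [m1 [l [infA1 _ _ stabA]]]] := stabilize_labels GG nn_gt (fun _ _ => tt) epsA0 inf0.
pose m := m1.+1; have m0 : 0 < m%:R :> R by rewrite ltr0n.
pose tau := e / (512 * m%:R).
have tau0 : 0 < tau by rewrite divr_gt0 // mulr_gt0.
have tauE : 2 * tau * m%:R = e / 256 by rewrite /tau; field; rewrite gt_eqF.
have tau1 : tau <= 1.
  have : 1 <= m%:R :> R by rewrite ler1n.
  by move=> /(ler_wpM2l (ltW tau0)); lra.
pose epsB := e * tau ^+ 2 / (32 * 256).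
have epsB0 : 0 < epsB.
  by apply: divr_gt0; apply: mulr_gt0 => //; exact: exprn_gt0.
have epsBE : 32 * epsB / tau ^+ 2 = e / 256 by rewrite /epsB; field; rewrite gt_eqF.
(* Pairs inside a block will cost [2 / K <= e / 32]. *)
pose K0 := Num.bound (64 / e).
have K0_gt : 64 / e < K0%:R by apply: archi_boundP; rewrite divr_ge0 // ltW.
have K00 : (0 < K0)%N by rewrite -(ltr0n R); apply: le_lt_trans K0_gt; rewrite divr_ge0 // ltW.
have [A2 [K [infA2 subA2 K0K stabB]]] := stabilize_buckets nn_gt l epsB0 infA1 K00.
have K_gt0 : (0 < K)%N by exact: leq_trans K0K.
have KR0 : 0 < K%:R :> R by rewrite ltr0n.
have KE : 2 / K%:R <= e / 32.
  have : 64 / e <= K%:R by apply: le_trans (ltW K0_gt) _; rewrite ler_nat.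
  by rewrite ler_pdivrMr // ler_pdivrMr // => h; lra.
(* The intended value of [beta * (K * m)], which enters the total cost once alone and once with the
   factor [768 * C1 * sg]. *)
pose t := e / (256 * (1 + 768 * C1 * sg)).
have Cs0 : 0 <= 768 * C1 * sg.
  by apply: mulr_ge0 (ltW sg0); apply: mulr_ge0 (ltW C10).
have den0 : 0 < 256 * (1 + 768 * C1 * sg) by move: Cs0; clear; lra.
have t0 : 0 < t by rewrite divr_gt0.
have tE : t * (1 + 768 * C1 * sg) = e / 256 by rewrite /t; field; rewrite gt_eqF //; move: Cs0; clear; lra.
have tE1 : t <= e / 256 by have := mulr_ge0 (ltW t0) Cs0; move: tE; clear; lra.
have tE2 : t * (768 * C1 * sg) <= e / 256 by move: tE t0; clear; lra.
pose beta := t / (K%:R * m%:R).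
have beta0 : 0 < beta by rewrite divr_gt0 // mulr_gt0.
have betaE : beta * (K%:R * m%:R) = t by rewrite divfK // gt_eqF // mulr_gt0.
pose D := Num.bound beta^-1.
have D_gt : beta^-1 < D%:R by apply: archi_boundP; rewrite invr_ge0 ltW.
(* This data has finitely many values, so infinitely many graphs of the sequence share it. *)
pose prof q := (dense_triples (GG q) eta (l q), [ffun ka : 'I_K * 'I_m =>
    inord ((D * #|block_class K (l q) ka.1 ka.2|) %/ nn q) : 'I_D.+1]).
have [pr infA3] := pigeonhole_infinite prof infA2.
(* The small graph, to be repaired, with enough vertices for [K] balanced blocks. *)
have [q1 q1K [A2q1 prq1]] := infA3 (2 * K)%N.
set n := nn q1.
have Kn : (2 * K <= n)%N by apply: leq_trans q1K (ltnW (nn_gt q1)).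
have n1 : (1 < n)%N by apply: leq_trans Kn; rewrite -{1}[2%N]muln1 leq_mul2l.
have n0 : (0 < n)%N by exact: ltnW.
have nR0 : 0 < n%:R :> R by rewrite ltr0n.
pose epsI := e * tau ^+ 2 / (256 * (64 * n%:R ^+ 4 * K%:R ^+ 2)).
have epsI0 : 0 < epsI.
  have nK : 0 < 64 * n%:R ^+ 4 * K%:R ^+ 2 :> R.
    by apply: mulr_gt0; [apply: mulr_gt0 => // |]; exact: exprn_gt0.
  by apply: divr_gt0; apply: mulr_gt0 => //; exact: exprn_gt0.
have epsIE : 64 * n%:R ^+ 4 * K%:R ^+ 2 / tau ^+ 2 * epsI = e / 256.
  by rewrite /epsI; field; rewrite !gt_eqF.
pose kappa := (eta / 4) ^+ n / n%:R.
have kappa0 : 0 < kappa by rewrite divr_gt0 // exprn_gt0 // divr_gt0.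
have kappaE : kappa * n%:R <= (eta / 4) ^+ n by rewrite divfK // gt_eqF.
pose epsC := epsI / 2 * ((eta / 4) ^+ 2 * kappa ^+ 2).
have eta4 : 0 < eta / 4 by rewrite divr_gt0.
have epsC0 : 0 < epsC.
  by apply: mulr_gt0; [exact: divr_gt0 | apply: mulr_gt0; exact: exprn_gt0].
have M0 : (0 < K * (2 * n))%N by rewrite !muln_gt0 K_gt0.
(* Pairing the class with the sub-block makes [W] refine both. *)
pose fine_label q (x : 'I_(nn q)) : 'I_m * 'I_(K * (2 * n)) := (l q x, Ordinal (bucket_lt x M0)).
have [A4 [mC [W [infA4 subA4 Wref stabC]]]] :=
  stabilize_labels GG nn_gt fine_label epsC0 infA3.
pose b := epsI / (4 * mC.+1%:R).
have mC0 : 0 < mC.+1%:R :> R by rewrite ltr0n.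
have b0 : 0 < b by rewrite divr_gt0 // mulr_gt0.
have bE : 4 * (b * #|'I_mC.+1|%:R) <= epsI.
  rewrite card_ord (_ : 4 * (b * mC.+1%:R) = epsI) //.
  by rewrite /b; move: (mC.+1%:R) mC0 => c c0; field; rewrite gt_eqF.
have [NA hNA] := stabA mC.+1.
have [NB hNB] := stabB (2 * n)%N (ltn_trans n0 (ltn_Pmull (leqnn 2) n0)).
(* The number of labels of [witness_label] over a partition with [mC.+1] labels. *)
have [NC hNC] := stabC (mC.+1 * 2 ^ (mC.+1 * #|Sigma|) * 2 ^ (mC.+1 * #|Sigma|))%N.
have kb0 : 0 < kappa ^+ n * b ^+ n by apply: mulr_gt0; exact: exprn_gt0.
(* Beyond [ND], the proportion of bad tuples, which is below [2 / q2], is less than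
   [kappa ^+ n * b ^+ n]. *)
pose ND := Num.bound (2 / (kappa ^+ n * b ^+ n)).
have ND_gt : 2 / (kappa ^+ n * b ^+ n) < ND%:R by apply: archi_boundP; rewrite divr_ge0 // ltW.
(* The large graph, beyond all thresholds and with the same finite data as the small one. *)
have [q2 q2_ge A4q2] := infA4 (NA + NB + NC + ND + n + 2 * (K * (2 * n)))%N.
have [NA_le NB_le NC_le [ND_le nq M_le]] := leq_sum6 q2_ge.
set N := nn q2; have N0 : (0 < N)%N := nn0 q2.
have NR0 : 0 < N%:R :> R by rewrite ltr0n.
have [A2q2 prq2] := subA4 q2 A4q2.
have nN : (2 * (K * (2 * n)) <= N)%N.
  by apply: leq_trans (ltnW (nn_gt q2)); exact: M_le.
have prof12 : prof q1 = prof q2 by rewrite prq1 prq2.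
have triples : dense_triples (GG q1) eta (l q1) = dense_triples (GG q2) eta (l q2) :=
  congr1 fst prof12.
have profile := profile_le K_gt0 n0 N0 beta0 D_gt (congr1 snd prof12).
have W_lab : refines (W q2) (l q2) by move=> x y /(Wref q2 A4q2) [].
have W_fine (x y : 'I_N) : W q2 x = W q2 y -> bucket (K * (2 * n)) x = bucket (K * (2 * n)) y.
  by move=> /(Wref q2 A4q2) [].
have gA : \sum_x \sum_y density_gap R (GG q2) (l q2) (W q2) x y <= epsA * N%:R ^+ 2.
  rewrite sum_density_gap; apply: hNA => //; last by rewrite card_ord.
  - exact: subA2.
have devB : \sum_a \sum_x deviation R n K (l q2) a x ^+ 2 <= epsB * N%:R.
  by apply: hNB.
have irrC : \sum_x \sum_y (exceptional (GG q2) (W q2) eta kappa b x y)%:R <= epsI * N%:R ^+ 2.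
  apply: sum_exceptional => //; try exact: ltW.
  apply: hNC => //.
  - by rewrite card_witness_label card_ord.
  - exact: witness_label_refines.
have theta1 : beta * (K%:R * m%:R) <= 1 by rewrite betaE; move: tE1 e1; clear; lra.
have gap_ge0 (x y : 'I_N) : 0 <= density_gap R (GG q2) (l q2) (W q2) x y.
  by apply: sumr_ge0 => c _; exact: sqr_ge0.
have gap_le (x y : 'I_N) : density_gap R (GG q2) (l q2) (W q2) x y <= sg.
  exact: sqr_density_gap_le.
have := choose_points n0 Kn nN tau0 tau1 (ltW beta0) (ltW sg0) (ltW C10) profile devB
  gap_ge0 gap_le gA irrC theta1.
set total := (X in X < 1 -> _).
have total_le : total <= 6 * (e / 256).
  have : K%:R * m%:R * beta = t by rewrite mulrC betaE.
  by rewrite /total betaE epsBE epsIE tauE => ->; move: epsAE tE1 tE2; clear; lra.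
case; first by apply: le_lt_trans total_le _; move: e0 e1; clear; lra.
move=> y [ok [y_incr y_reg y_ok y_cost]].
(* Going down from length [q2] to [n] does not increase the proportion of bad tuples. *)
have few : #|bad_tuples P (GG q2) n|%:R < kappa ^+ n * (b * N%:R) ^+ n.
  have h1 := bad_tuplesS P (GG q2) nq; have h2 := GG_bad q2; rewrite -/N in h1 h2.
  have q20 : (0 < N ^ q2)%N by rewrite expn_gt0 N0.
  have Nn0 : (0 < N ^ n)%N by rewrite expn_gt0 N0.
  have h3 : (q2 * #|bad_tuples P (GG q2) n| < 2 * N ^ n)%N.
    exact: ratio_lt h1 h2.
  have h4 : 2 / (kappa ^+ n * b ^+ n) < q2%:R.
    apply: lt_le_trans ND_gt _; by rewrite ler_nat.
  have q2R : 0 < q2%:R :> R by apply: le_lt_trans h4; rewrite divr_ge0 // ltW.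
  have -> : kappa ^+ n * (b * N%:R) ^+ n = kappa ^+ n * b ^+ n * N%:R ^+ n.
    by rewrite [(b * _) ^+ n]exprMn mulrA.
  rewrite -(ltr_pM2l q2R).
  move: h3; rewrite -(ltr_nat R) !natrM natrX => h3; apply: (lt_le_trans h3).
  rewrite mulrA ler_wpM2r ?exprn_ge0 //.
  by move: h4; rewrite ltr_pdivrMr // => /ltW.
have sg_eta : eta / 2 * #|Sigma|%:R < 1 by move: eta_sg e1; rewrite /sg; clear; lra.
have H_in := repair_in (GG q1) n1 eta0 sg_eta eta1 kappa0 kappaE b0 W_fine few y_incr y_reg.
have H_cost := repair_cost Kn n1 eta0 triples y_ok (erefl C1) y_cost.
have [_ /(_ _ H_in)] := GG_far q1; rewrite -/n => far.
have n2 : 0 < n%:R * n%:R :> R by rewrite mulr_gt0.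
have bin : n%:R * n%:R <= 4 * 'C(n, 2)%:R :> R by rewrite -!natrM ler_nat bin2_ge.
have lo : e * (n%:R * n%:R) <= 4 * (eps * 'C(n, 2)%:R).
  have := ler_wpM2l (ltW eps0) bin; have := ler_wpM2r (ltW n2) e_eps; clear; lra.
have hi := le_trans far H_cost; rewrite -/sg eta_sg in hi.
(* The contributions add up to [16/256 + 8/256 + 12/256 = 9/64], and four times this is less than 1,
   against [lo]. *)
have : (n%:R * n%:R) * (e / 16 + 2 / K%:R + 2 * total) <= (n%:R * n%:R) * (9 / 64 * e).
  rewrite ler_wpM2l ?(ltW n2) //.
  apply: (le_trans (lerD (lerD (lexx _) KE) (ler_wpM2l (ler0n R 2) total_le))).
  by clear; lra.
move: hi; rewrite expr2 -/total => /le_trans h /h.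
have := mulr_gt0 n2 e0; move: lo; clear; lra.
Qed.

Theorem theorem1p5 (R : realType) (Sigma : finType) (hSigma : (2 <= #|Sigma|)%N)
    (P : ograph_property Sigma) (hP : hereditary P) :
  strongly_testable R P.
Proof.
have Sigma_gt0 : (0 < #|Sigma|)%N by exact: ltnW.
have /card_gt0P[c0 _] := Sigma_gt0.
apply: testable_of_bad_tuples c0 hP _ => eps; exact: bad_tuples_of_far.
Qed.
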